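(* Let $n\ge2$, let $\beta\vdash n-1$, and let $\gamma\vdash n-2$ be a partition obtained from $\beta$ by removing one box. Then for every partition $\nu\vdash n$ obtained from $\beta$ by adding one box the number $c(\nu/\beta)-c(\beta/\gamma)$ is nonzero, and for every complex Hermitian positive-semidefinite $n\times n$ matrix $A$, $$B_{\beta,\gamma}(A)=\sum_{\nu}\frac{d_\nu(A)}{c(\nu/\beta)-c(\beta/\gamma)}\ge0,$$ where the sum is over all partitions $\nu\vdash n$ obtained from $\beta$ by adding one box.
   Context: For $\lambda\vdash n$, $\chi^\lambda$ is the corresponding irreducible character of $S_n$ and $d_\lambda(A)=\sum_{\sigma\in S_n}\chi^\lambda(\sigma)\prod_{i=1}^n a_{i,\sigma(i)}$ for an $n\times n$ matrix $A=(a_{ij})$. The content of a box in row $i$ and column $j$ is $j-i$; when $\nu$ is obtained from $\beta$ by adding one box, $c(\nu/\beta)$ denotes the content of that box (and similarly $c(\beta/\gamma)$). *)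

(* Defs.v *)
From HB Require Import structures.
From mathcomp Require Import all_boot all_order all_algebra all_fingroup.
From mathcomp Require Import mxrepresentation sesquilinear spectral reals complex.

Set Implicit Arguments.
Unset Strict Implicit.
Unset Printing Implicit Defensive.

Import GRing.Theory Num.Theory.
Local Open Scope ring_scope.
Local Open Scope complex_scope.
Local Open Scope sesquilinear_scope.

(** A partition of [n] is stored as a nonincreasing [n]-tuple of row lengths
    with sum [n], padded with zeros: every partition of [n] has at most [n]
    nonzero parts, each of size at most [n]. *)

Definition rows n (t : n.-tuple 'I_n.+1) : seq nat := [seq val i | i <- t].

Definition is_intpart n (t : n.-tuple 'I_n.+1) : bool :=
  sorted geq (rows t) && (sumn (rows t) == n).

Record intpart n :=
  IntPart { intpart_val : n.-tuple 'I_n.+1; _ : is_intpart intpart_val }.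

HB.instance Definition _ n := [isSub for @intpart_val n].
HB.instance Definition _ n := [Finite of intpart n by <:].

Definition shape_of n (la : intpart n) : seq nat := rows (intpart_val la).

(** Rows and columns are numbered from 0; [part la i] is 0 for [i >= n]. *)
Definition part n (la : intpart n) (i : nat) : nat := nth 0%N (shape_of la) i.

Definition adds_box m n (mu : intpart m) (la : intpart n) : bool :=
  [exists r : 'I_n, [forall i : 'I_n, part la i == (part mu i + (i == r))%N]].

Definition content (b : nat * nat) : int := b.2%:Z - b.1%:Z.

(** When [adds_box mu la], the new box lies in the only row where the two
    diagrams differ, just after the last box of [mu] in that row. *)
Definition new_row m n (la : intpart n) (mu : intpart m) : nat :=
  find (fun i => part la i != part mu i) (iota 0 n).

Definition skew_content m n (la : intpart n) (mu : intpart m) : int :=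
  let r := new_row la mu in content (r, part mu r).

(** The boxes of [la] are numbered by ['I_n] along the rows, from top to bottom
    and from left to right; [box_row] and [box_col] recover the coordinates of a
    box in this tableau. *)
Definition box_row n (la : intpart n) (k : 'I_n) : nat :=
  reshape_index (shape_of la) k.
Definition box_col n (la : intpart n) (k : 'I_n) : nat :=
  reshape_offset (shape_of la) k.

Definition row_stab n (la : intpart n) : {set 'S_n} :=
  [set s : 'S_n | [forall k, box_row la (s k) == box_row la k]].
Definition col_stab n (la : intpart n) : {set 'S_n} :=
  [set s : 'S_n | [forall k, box_col la (s k) == box_col la k]].

Section Immanants.
Variable F : fieldType.

Definition Sn_regular n := regular_repr F [set: 'S_n]%G.

(** The element [s] of the group algebra of ['S_n], as a row vector. *)
Definition gelt n (s : 'S_n) : 'rV[F]_#|[set: 'S_n]%G| :=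
  delta_mx 0 (gring_index [set: 'S_n]%G s).

Definition young_symmetrizer n (la : intpart n) : 'rV[F]_#|[set: 'S_n]%G| :=
  \sum_(p in row_stab la) \sum_(q in col_stab la) (-1) ^+ q *: gelt (p * q)%g.

(** The Specht module of [la] is the right ideal of the group algebra generated
    by the Young symmetrizer, on which ['S_n] acts by right multiplication. *)
Definition specht_repr n (la : intpart n) :=
  submod_repr (cyclic_mx_module (Sn_regular n) (young_symmetrizer la)).

(** The irreducible character chi^la, with values in [F]. *)
Definition Sn_char n (la : intpart n) (s : 'S_n) : F :=
  \tr (specht_repr la s).

Definition immanant n (la : intpart n) (A : 'M[F]_n) : F :=
  \sum_(s : 'S_n) Sn_char la s * \prod_i A i (s i).

End Immanants.

Definition psdmx (R : realType) n (A : 'M[R[i]]_n) : Prop :=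
  A \is hermsymmx /\ forall x : 'cV[R[i]]_n, 0 <= (x ^t* *m A *m x) 0 0.

(* Main.v *)
(* The numbers [1 / (c(nu/beta) - c(beta/gamma))] are the diagonal entries of the
   last transposition [s] in Young's orthogonal form.  In the group algebra, let
   [y] be the product of the central idempotents of [S_{n-1}] and [S_{n-2}]
   attached to [beta] and [gamma].  The Jucys-Murphy relation
   [X_n s = s X_{n-1} + 1] shows that the conjugation average of [y s y] acts on
   the component of [nu] by a positive multiple of that entry, so the sum of
   immanants is, up to a positive factor, the value on this average of the linear
   form [u |-> \prod_i A (u i) i].  Writing [A] as a Gram matrix, [s] contracts the
   last two tensor factors and the value on [y^* s y] is a sum of squares.
   The representation theory needed (contents as eigenvalues, branching rule,
   completeness) follows from von Neumann's lemma on Young symmetrizers together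
   with the relation [DU - UD = 1] on Young's lattice, which forces the
   multiplicities in the branching rule to be 0 or 1. *)
From HB Require Import structures.
From mathcomp Require Import all_boot all_order all_algebra all_fingroup.
From mathcomp Require Import mxrepresentation sesquilinear spectral.
From mathcomp Require Import reals complex.
From mathcomp Require Import zify ring.
Require Import Defs.

Set Implicit Arguments.
Unset Strict Implicit.
Unset Printing Implicit Defensive.

Import Order.TTheory GRing.Theory Num.Theory.
Local Open Scope ring_scope.

(** * Group algebras *)

(** Modules are handled through quasi-idempotents of the group algebra: the trace of left
    multiplication by [x] is the order of the group times [x 1], so dimensions and multiplicities
    become coefficients at the identity, integral because they are ranks. The obstacle is
    completeness of the central idempotents. It is not obtained by counting conjugacy classes but
    proved together with the branching rule, by induction on the size: at first a restriction
    multiplicity is only known to be positive when a box is added, and dimension counts in both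
    directions leave room for nothing else. The conjugation average is what turns [y s y] into a
    combination of characters; it costs nothing in positivity, since conjugating by a permutation
    only renumbers the rows and columns of [A] simultaneously, and a renumbered Gram matrix is a
    Gram matrix. The positive factor is the dimension of the Specht module of gamma, the rank of [y]
    on each component that contains beta. *)

Definition galg (F : fieldType) (gT : finGroupType) := {ffun gT -> F^o}.

Section GroupAlgebra.
Variables (F : fieldType) (gT : finGroupType).
Local Notation A := (galg F gT).
Implicit Types (x y z : A) (g h k : gT) (c : F).

HB.instance Definition _ := GRing.Lmodule.copy A {ffun gT -> F^o}.

Lemma galgP x y : (forall g, x g = y g) -> x = y.
Proof. by move=> e; apply/ffunP. Qed.

Lemma gaddE x y g : (x + y) g = x g + y g. Proof. exact: ffunE. Qed.
Lemma gscaleE c x g : (c *: x) g = c * x g. Proof. exact: ffunE. Qed.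
Lemma goppE x g : (- x) g = - x g. Proof. exact: ffunE. Qed.
Lemma gsumE I (r : seq I) (P : pred I) (f : I -> A) g :
  (\sum_(i <- r | P i) f i) g = \sum_(i <- r | P i) f i g.
Proof. exact: sum_ffunE. Qed.

Definition gdelta g : A := [ffun h => (h == g)%:R].
Definition gmul x y : A := [ffun g => \sum_h x h * y (h^-1 * g)%g].

Lemma gmulA : associative gmul.
Proof.
move=> x y z; apply/galgP=> g; rewrite !ffunE.
under eq_bigr => h _ do rewrite ffunE big_distrr /=.
under [RHS]eq_bigr => h _ do rewrite ffunE big_distrl /=.
rewrite [RHS]exchange_big /=; apply: eq_bigr => h _.
rewrite (reindex_inj (mulgI h^-1)%g) /=; apply: eq_bigr => k _.
by rewrite mulrA invMg invgK mulgA mulgK.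
Qed.

Lemma gmul1x : left_id (gdelta 1) gmul.
Proof.
move=> x; apply/galgP=> g; rewrite ffunE (bigD1 1%g) //= big1 => [|h /negPf nh].
  by rewrite ffunE eqxx mul1r invg1 mul1g addr0.
by rewrite ffunE nh mul0r.
Qed.

Lemma gmulx1 : right_id (gdelta 1) gmul.
Proof.
move=> x; apply/galgP=> g; rewrite ffunE (bigD1 g) //= big1 => [|h nh].
  by rewrite ffunE mulVg eqxx mulr1 addr0.
by rewrite ffunE -eq_mulVg1 (negPf nh) mulr0.
Qed.

Lemma gmulDl : left_distributive gmul +%R.
Proof.
move=> x y z; apply/galgP=> g; rewrite gaddE !ffunE -big_split /=.
by apply: eq_bigr => h _; rewrite gaddE mulrDl.
Qed.

Lemma gmulDr : right_distributive gmul +%R.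
Proof.
move=> x y z; apply/galgP=> g; rewrite gaddE !ffunE -big_split /=.
by apply: eq_bigr => h _; rewrite gaddE mulrDr.
Qed.

Lemma gdelta1_neq0 : gdelta 1 != 0.
Proof. by apply/eqP => /ffunP/(_ 1%g)/eqP; rewrite !ffunE eqxx oner_eq0. Qed.

HB.instance Definition _ := GRing.Zmodule_isNzRing.Build A
  gmulA gmul1x gmulx1 gmulDl gmulDr gdelta1_neq0.

Lemma gscaleAl c x y : c *: (x * y) = c *: x * y.
Proof.
apply/galgP=> g; rewrite gscaleE !ffunE big_distrr /=.
by apply: eq_bigr => h _; rewrite gscaleE mulrA.
Qed.

HB.instance Definition _ := GRing.Lmodule_isLalgebra.Build F A gscaleAl.

Lemma gscaleAr c x y : c *: (x * y) = x * (c *: y).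
Proof.
apply/galgP=> g; rewrite gscaleE !ffunE big_distrr /=.
by apply: eq_bigr => h _; rewrite gscaleE mulrCA.
Qed.

HB.instance Definition _ := GRing.Lalgebra_isAlgebra.Build F A gscaleAr.

Lemma gmulE x y g : (x * y) g = \sum_h x h * y (h^-1 * g)%g.
Proof. exact: ffunE. Qed.

Lemma gdeltaE g h : gdelta g h = (h == g)%:R. Proof. exact: ffunE. Qed.

Lemma gdelta1 : gdelta 1 = 1. Proof. by []. Qed.

Lemma gdeltaMl g x h : (gdelta g * x) h = x (g^-1 * h)%g.
Proof.
rewrite gmulE (bigD1 g) //= big1 => [|k /negPf nk].
  by rewrite gdeltaE eqxx mul1r addr0.
by rewrite gdeltaE nk mul0r.
Qed.

Lemma gdeltaMr g x h : (x * gdelta g) h = x (h * g^-1)%g.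
Proof.
rewrite gmulE (bigD1 (h * g^-1)%g) //= big1 => [|k nk].
  by rewrite gdeltaE invMg invgK mulgKV eqxx mulr1 addr0.
rewrite gdeltaE; case: eqP => [e|]; last by rewrite mulr0.
by case/eqP: nk; rewrite -e invMg invgK mulKVg.
Qed.

Lemma gdeltaM g h : gdelta (g * h) = gdelta g * gdelta h.
Proof.
apply/galgP=> k; rewrite gdeltaMl !gdeltaE.
by rewrite -[in RHS](inj_eq (mulgI g)) mulKVg.
Qed.

Lemma galg_sum x : x = \sum_g x g *: gdelta g.
Proof.
apply/galgP=> h; rewrite gsumE (bigD1 h) //= big1 => [|k nk].
  by rewrite gscaleE gdeltaE eqxx mulr1 addr0.
by rewrite gscaleE gdeltaE eq_sym (negPf nk) mulr0.
Qed.

Lemma gmul1C x y : (x * y) 1%g = (y * x) 1%g.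
Proof.
rewrite !gmulE (reindex_inj invg_inj) /=; apply: eq_bigr => g _.
by rewrite !mulg1 invgK mulrC.
Qed.

Definition gconj g x := gdelta g * x * gdelta g^-1.
Definition gavg x := \sum_g gconj g x.
Definition gcentral z := forall x, z * x = x * z.

Lemma gdeltaK g : gdelta g * gdelta g^-1 = 1.
Proof. by rewrite -gdeltaM mulgV. Qed.

Lemma gdeltaVK g : gdelta g^-1 * gdelta g = 1.
Proof. by rewrite -gdeltaM mulVg. Qed.

Lemma gcentralP z : (forall g, z * gdelta g = gdelta g * z) -> gcentral z.
Proof.
move=> cz x; rewrite (galg_sum x) mulr_suml mulr_sumr; apply: eq_bigr => g _.
by rewrite -scalerAl -scalerAr cz.
Qed.

Lemma gconj_gdelta g h : gconj g (gdelta h) = gdelta (h ^ g^-1).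
Proof. by rewrite /gconj -!gdeltaM conjgE invgK mulgA. Qed.

Lemma gconjE g x h : gconj g x h = x (h ^ g)%g.
Proof. by rewrite /gconj gdeltaMr gdeltaMl invgK conjgE mulgA. Qed.

Lemma gconjM g h x : gconj g (gconj h x) = gconj (g * h) x.
Proof. by apply/galgP=> k; rewrite !gconjE conjgM. Qed.

Lemma gconj_mul g x y : gconj g (x * y) = gconj g x * gconj g y.
Proof. by rewrite /gconj !mulrA -[in RHS](mulrA _ _ (gdelta g)) gdeltaVK mulr1. Qed.

Lemma gavg_central x : gcentral (gavg x).
Proof.
apply: gcentralP => g; rewrite /gavg mulr_suml mulr_sumr.
rewrite [LHS](reindex_inj (mulgI g)) /=; apply: eq_bigr => h _.
by rewrite -gconjM /gconj -!mulrA gdeltaVK mulr1.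
Qed.

Lemma gavg1E x : (gavg x) 1%g = #|gT|%:R * x 1%g.
Proof.
rewrite gsumE (eq_bigr (fun=> x 1%g)) => [|g _].
  by rewrite sumr_const mulr_natl; congr (_ *+ _); apply: eq_card.
by rewrite gconjE conj1g.
Qed.

Lemma gavgZ c x : gavg (c *: x) = c *: gavg x.
Proof.
by rewrite scaler_sumr; apply: eq_bigr => g _; rewrite /gconj -scalerAr -scalerAl.
Qed.

Lemma gavg_sum I (r : seq I) (P : pred I) (f : I -> A) :
  gavg (\sum_(i <- r | P i) f i) = \sum_(i <- r | P i) gavg (f i).
Proof.
rewrite /gavg exchange_big /=; apply: eq_bigr => g _.
by rewrite /gconj mulr_sumr mulr_suml.
Qed.

Lemma gavgMl z x : gcentral z -> gavg (z * x) = z * gavg x.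
Proof.
move=> cz; rewrite mulr_sumr; apply: eq_bigr => g _.
by rewrite /gconj !mulrA cz.
Qed.

Lemma gavg_conj g x : gavg (gconj g x) = gavg x.
Proof.
rewrite /gavg [RHS](reindex_inj (mulIg g)) /=.
by apply: eq_bigr => h _; rewrite gconjM.
Qed.

(** By linearity [x] is a group element [g], and then the two products are conjugate under [g]. *)
Lemma gavgC x y : gavg (x * y) = gavg (y * x).
Proof.
rewrite (galg_sum x) mulr_suml mulr_sumr !gavg_sum; apply: eq_bigr => g _.
rewrite -scalerAl -scalerAr !gavgZ -[in RHS](gavg_conj g); congr (_ *: gavg _).
by rewrite /gconj -!mulrA gdeltaK mulr1.
Qed.

(** Row [i] lists the coefficients of [x * gdelta (enum_val i)]: the matrices act on row vectors, so
    left multiplications compose in reverse order. *)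
Definition lmul_mx x : 'M[F]_#|gT| :=
  \matrix_(i, j) x (enum_val j * (enum_val i)^-1)%g.
Definition rmul_mx x : 'M[F]_#|gT| :=
  \matrix_(i, j) x ((enum_val i)^-1 * enum_val j)%g.

Lemma sum_enum_val (f : gT -> F) :
  \sum_(i < #|gT|) f (enum_val i) = \sum_g f g.
Proof. by rewrite [RHS](reindex _ (onW_bij _ (enum_val_bij gT))). Qed.

Lemma lmul_mxM x y : lmul_mx x *m lmul_mx y = lmul_mx (y * x).
Proof.
apply/matrixP=> i k; rewrite !mxE gmulE.
under eq_bigr => j _ do rewrite !mxE.
rewrite (sum_enum_val (fun g =>
  x (g * (enum_val i)^-1)%g * y (enum_val k * g^-1)%g)).
rewrite (reindex_inj invg_inj) (reindex_inj (mulgI (enum_val k)^-1%g)) /=.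
by apply: eq_bigr => g _; rewrite mulrC !invgK mulKVg invMg invgK !mulgA.
Qed.

Lemma rmul_mxM x y : rmul_mx x *m rmul_mx y = rmul_mx (x * y).
Proof.
apply/matrixP=> i k; rewrite !mxE gmulE.
under eq_bigr => j _ do rewrite !mxE.
rewrite (sum_enum_val (fun g =>
  x ((enum_val i)^-1 * g)%g * y (g^-1 * enum_val k)%g)).
rewrite (reindex_inj (mulgI (enum_val i))) /=.
by apply: eq_bigr => g _; rewrite mulKg invMg mulgA.
Qed.

Lemma lmul_rmulE x y i j : (lmul_mx x *m rmul_mx y) i j =
  (x * gdelta (enum_val i) * y) (enum_val j).
Proof.
rewrite !mxE gmulE; under eq_bigr => k _ do rewrite !mxE.
rewrite (sum_enum_val (fun g =>
  x (g * (enum_val i)^-1)%g * y (g^-1 * enum_val j)%g)).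
by apply: eq_bigr => g _; rewrite gdeltaMr.
Qed.

Lemma lmul_rmulC x y : lmul_mx x *m rmul_mx y = rmul_mx y *m lmul_mx x.
Proof.
apply/matrixP=> i j; rewrite lmul_rmulE -mulrA gmulE !mxE.
under [RHS]eq_bigr => k _ do rewrite !mxE.
rewrite (sum_enum_val (fun g =>
  y ((enum_val i)^-1 * g)%g * x (enum_val j * g^-1)%g)).
rewrite (reindex_inj invg_inj) (reindex_inj (mulIg (enum_val j)^-1%g)) /=.
by apply: eq_bigr => g _; rewrite mulrC gdeltaMl !invgK mulgKV invMg invgK.
Qed.

(** The trace of [u |-> x * u * y], summed over the basis of group elements. *)
Lemma mxtrace_lmul_rmul x y : \tr (lmul_mx x *m rmul_mx y) = (x * gavg y) 1%g.
Proof.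
rewrite /mxtrace; under eq_bigr => i _ do rewrite lmul_rmulE.
rewrite (sum_enum_val (fun g => (x * gdelta g * y) g)) mulr_sumr gsumE.
by apply: eq_bigr => g _; rewrite /gconj !mulrA gdeltaMr mul1g invgK.
Qed.

End GroupAlgebra.

Arguments gdelta {F gT} g.

(* Through a rank factorization [L = C *m B], the hypothesis reads [B *m C =
  k%:M]. *)
Lemma mxtrace_quasi_idem (F : fieldType) n (L : 'M[F]_n) (k : F) :
  L *m L = k *: L -> \tr L = k * (\rank L)%:R.
Proof.
move=> LL; rewrite -{1}(mulmx_base L) mxtrace_mulC.
suff -> : row_base L *m col_base L = k%:M by rewrite mxtrace_scalar mulr_natr.
have /row_freeP[D BD] := row_base_free L.
have [D' DC] := row_fullP (col_base_full L).
have eL := mulmx_base L.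
move: (\rank L) (row_base L) (col_base L) D D' eL BD DC => r B C D D' eL BD DC.
have : D' *m (L *m L) *m D = D' *m (k *: L) *m D by rewrite LL.
rewrite -eL -scalemxAr -scalemxAl !mulmxA DC mul1mx BD -!mulmxA BD mulmx1 => ->.
by rewrite scalemx1.
Qed.

(** * Primitive idempotents *)

Section Primitive.
Variables (F : numFieldType) (gT : finGroupType).
Local Notation A := (galg F gT).
Local Notation nG := (#|gT|%:R : F).
Implicit Types (e x y z : A) (g : gT).

Lemma card_galg_neq0 : nG != 0.
Proof. by rewrite pnatr_eq0 -lt0n; apply/card_gt0P; exists 1%g. Qed.

(** Normalized by the coefficient at the identity rather than by idempotency, as Young symmetrizers
    are; the scalar [kap e] in [e * e = kap e *: e] then carries the dimension. *)
Definition primitive e :=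
  e 1%g = 1 /\ forall x, exists c : F, e * x * e = c *: e.

Definition kap e : F := (e * e) 1%g.

(* The normalization comes from [e * gavg e = kap e ^+ 2 *: e]. *)
Definition zid e : A := (kap e ^- 2) *: gavg e.

Section OnePrimitive.
Variables (e : A) (prim_e : primitive e).

(** The scalar is read off at the identity, where cyclicity turns [e * x * e] into [e * e * x]. *)
Lemma prim_sandwich x : e * x * e = (kap e * (e * x) 1%g) *: e.
Proof.
have [e1 /(_ x)[c ex]] := prim_e; have [c' ee] := (prim_e.2 1).
rewrite mulr1 in ee; have kE : kap e = c' by rewrite /kap ee gscaleE e1 mulr1.
rewrite ex; congr (_ *: _).
have : (e * x * e) 1%g = c by rewrite ex gscaleE e1 mulr1.
by rewrite gmul1C mulrA ee -scalerAl gscaleE kE.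
Qed.

Lemma prim_sq : e * e = kap e *: e.
Proof. by rewrite -{1}[e]mulr1 prim_sandwich mulr1 prim_e.1 mulr1. Qed.

Lemma mxtrace_lmul x : \tr (lmul_mx x) = nG * x 1%g.
Proof.
rewrite /mxtrace (eq_bigr (fun=> x 1%g)) => [|i _]; last by rewrite mxE mulgV.
by rewrite sumr_const card_ord mulr_natl.
Qed.

(** The trace of left multiplication by [e], computed from its diagonal and from its rank. Hence
    [kap e] is the group order divided by the dimension of the right ideal of [e]. *)
Lemma card_kap : nG = kap e * (\rank (lmul_mx e))%:R.
Proof.
rewrite -mxtrace_quasi_idem ?mxtrace_lmul ?prim_e.1 ?mulr1 //.
rewrite lmul_mxM prim_sq.
by apply/matrixP=> i j; rewrite !mxE gscaleE.
Qed.

Lemma kap_neq0 : kap e != 0.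
Proof. by apply: contraNneq card_galg_neq0 => k0; rewrite card_kap k0 mul0r. Qed.

Lemma kap_real_gt0 : 0 < kap e.
Proof.
have r0 : 0 < (\rank (lmul_mx e))%:R :> F.
  rewrite lt0r ler0n andbT; apply: contraNneq card_galg_neq0 => r0.
  by rewrite card_kap r0 mulr0.
rewrite -(pmulr_lgt0 _ r0) -card_kap lt0r card_galg_neq0; exact: ler0n.
Qed.

Lemma prim_gavg : e * gavg e = kap e ^+ 2 *: e.
Proof.
rewrite mulr_sumr.
under eq_bigr => g _ do
  rewrite /gconj !mulrA prim_sandwich gdeltaMr mul1g -scalerAl.
have ee : e * e = \sum_g e g *: (e * gdelta g).
  rewrite [X in e * X](galg_sum e) mulr_sumr.
  by apply: eq_bigr => g _; rewrite -scalerAr.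
rewrite expr2 -scalerA -prim_sq ee scaler_sumr (reindex_inj invg_inj) /=.
by apply: eq_bigr => g _; rewrite scalerA invgK.
Qed.

Lemma zid_central : gcentral (zid e).
Proof. by move=> x; rewrite /zid -scalerAl gavg_central -scalerAr. Qed.

Lemma prim_zid : e * zid e = e.
Proof.
by rewrite -scalerAr prim_gavg scalerA mulVf ?scale1r // expf_neq0 // kap_neq0.
Qed.

Lemma zid1E : zid e 1%g = nG * kap e ^- 2.
Proof. by rewrite gscaleE gavg1E prim_e.1 mulr1 mulrC. Qed.

Lemma zid_avg x : gcentral x -> x * zid e = kap e ^- 2 *: gavg (x * e).
Proof. by move=> cx; rewrite /zid -scalerAr gavgMl. Qed.

Lemma zidK : zid e * zid e = zid e.
Proof. by rewrite zid_avg ?[zid e * e]zid_central ?prim_zid //;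
  apply: zid_central. Qed.

Lemma prim_central x : gcentral x -> x * e = (x * e) 1%g *: e.
Proof.
move=> cx; apply: (scalerI kap_neq0).
by rewrite scalerA [in RHS]cx -prim_sandwich -cx -mulrA prim_sq scalerAr.
Qed.

Lemma zid_eigen x (c : F) : gcentral x -> x * e = c *: e -> x * zid e = c *: zid e.
Proof. by move=> cx xe; rewrite zid_avg // xe gavgZ /zid !scalerA mulrC. Qed.

Lemma zid_scalar x : gcentral x -> exists c, x * zid e = c *: zid e.
Proof. by move=> cx; exists ((x * e) 1%g); apply/zid_eigen/prim_central. Qed.

(** An average is central, so it acts on the block of [e] by a scalar; comparing coefficients at the
    identity determines it. *)
Lemma gavg_zid x : gavg (x * zid e) = (kap e ^+ 2 * (x * zid e) 1%g) *: zid e.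
Proof.
have [c xc] := zid_scalar (gavg_central x).
have eq1: gavg (x * zid e) = c *: zid e.
  by rewrite -xc -!zid_central gavgMl //; apply: zid_central.
rewrite eq1; congr (_ *: _); move: (congr1 (fun y : A => y 1%g) eq1).
rewrite gavg1E gscaleE zid1E mulrCA => /(mulfI card_galg_neq0) ->.
by rewrite mulrCA mulfV ?mulr1 // expf_neq0 ?kap_neq0.
Qed.

(** The integer is the rank of [u |-> P * u * e], that is, the rank of [P] on the left ideal
    generated by [e]. If this map vanishes, so does every summand of [P * gavg e]. *)
Lemma prim_mult P : P * P = P ->
  exists2 r : nat, kap e * (P * zid e) 1%g = r%:R & r = 0%N -> P * zid e = 0.
Proof.
move=> PP; pose M := lmul_mx P *m rmul_mx e.
have MM : M *m M = kap e *: M.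
  rewrite /M mulmxA -(mulmxA _ (rmul_mx e)) -lmul_rmulC mulmxA lmul_mxM PP.
  rewrite -mulmxA rmul_mxM prim_sq; apply/matrixP => i j.
  by rewrite [RHS]mxE !lmul_rmulE -scalerAr gscaleE.
exists (\rank M).
  apply: (mulfI kap_neq0); rewrite -mxtrace_quasi_idem // mxtrace_lmul_rmul.
  rewrite /zid -scalerAr gscaleE mulrA -expr2 mulrA mulfV ?mul1r //.
  by rewrite expf_neq0 ?kap_neq0.
move/eqP; rewrite mxrank_eq0 => /eqP M0; suff PE : P * gavg e = 0.
  by rewrite /zid -scalerAr PE scaler0.
rewrite mulr_sumr big1 // => g _; rewrite /gconj !mulrA.
suff -> : P * gdelta g * e = 0 by rewrite mul0r.
apply/galgP=> h; have := lmul_rmulE P e (enum_rank g) (enum_rank h).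
by rewrite -/M M0 !enum_rankK mxE => <-; rewrite ffunE.
Qed.

End OnePrimitive.

Lemma idem_trace y : y * y = y ->
  exists2 r : nat, nG * y 1%g = r%:R & r = 0%N -> y = 0.
Proof.
move=> yy; exists (\rank (lmul_mx y)).
  rewrite -[RHS]mul1r -mxtrace_quasi_idem ?mxtrace_lmul // scale1r.
  by rewrite lmul_mxM yy.
move/eqP; rewrite mxrank_eq0 => /eqP y0; apply/galgP=> g.
move/matrixP: y0 => /(_ (enum_rank 1%g) (enum_rank g)).
by rewrite !mxE !enum_rankK invg1 mulg1 => ->; rewrite ffunE.
Qed.

Lemma zid_orth e e' : (forall x, e * x * e' = 0) -> zid e * zid e' = 0.
Proof.
move=> ee0; rewrite /zid -scalerAl -scalerAr -gavgMl; last exact: gavg_central.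
suff -> : gavg e * e' = 0 by rewrite /gavg big1 ?scaler0 // => g _;
  rewrite /gconj mulr0 mul0r.
rewrite mulr_suml big1 // => g _.
by rewrite /gconj -!mulrA (mulrA e) ee0 mulr0.
Qed.

End Primitive.

(** * Boxes of Young diagrams *)

Section Boxes.
Variables (n : nat) (la : intpart n).
Implicit Types (k : 'I_n) (i r c : nat).

Lemma size_shape : size (shape_of la) = n.
Proof. by rewrite /shape_of /rows size_map size_tuple. Qed.

Lemma sumn_shape : sumn (shape_of la) = n.
Proof. by case/andP: (valP la) => _ /eqP. Qed.

Lemma part_default i : (n <= i)%N -> part la i = 0%N.
Proof. by move=> ni; rewrite /part nth_default ?size_shape. Qed.

Lemma part_homo r r' : (r <= r')%N -> (part la r' <= part la r)%N.
Proof.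
move=> rr'; have [r'n|nr'] := ltnP r' n; last by rewrite (part_default nr').
have /andP[sla _] := valP la.
have geq_tr : transitive geq by move=> a b c /= ba cb; apply: leq_trans cb ba.
apply: (sorted_leq_nth geq_tr leqnn 0%N sla) => //;
  by rewrite inE -/(shape_of la) size_shape // (leq_ltn_trans rr').
Qed.

Lemma ltn_shape k : (k < sumn (shape_of la))%N.
Proof. by rewrite sumn_shape. Qed.

Lemma box_row_lt k : (box_row la k < n)%N.
Proof. by have := reshape_indexP (ltn_shape k); rewrite size_shape. Qed.

Lemma box_col_lt_part k : (box_col la k < part la (box_row la k))%N.
Proof. exact: reshape_offsetP (ltn_shape k). Qed.

Lemma box_col_lt k : (box_col la k < n)%N.
Proof. by apply: leq_ltn_trans (leq_subr _ _) (ltn_ord k). Qed.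

Lemma box_inj k k' :
  box_row la k = box_row la k' -> box_col la k = box_col la k' -> k = k'.
Proof.
move=> er ec; apply: val_inj; rewrite /= -(reshape_indexK (shape_of la) k).
rewrite -[RHS](reshape_indexK (shape_of la) k').
by rewrite -/(box_row la k) -/(box_col la k) er ec.
Qed.

Lemma box_exists r c : (c < part la r)%N ->
  exists2 k, box_row la k = r & box_col la k = c.
Proof.
move=> lc; have := flatten_indexP lc; rewrite sumn_shape => kn.
exists (Ordinal kn); first exact: flatten_indexKl.
exact: flatten_indexKr.
Qed.

Lemma part_le r : (part la r <= n)%N.
Proof.
rewrite leqNgt; apply/negP => lt_n; have [k _ kn] := box_exists lt_n.
by have := box_col_lt k; rewrite kn ltnn.
Qed.

Lemma sum_boxes (V : nmodType) (G : nat -> nat -> V) :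
  \sum_(k < n) G (box_row la k) (box_col la k) =
  \sum_(r < n) \sum_(c < n | (c < part la r)%N) G r c.
Proof.
pose h k := (Ordinal (box_row_lt k), Ordinal (box_col_lt k)).
rewrite pair_big_dep /= (reindex h) /=.
  by apply: eq_bigl => k; rewrite /= box_col_lt_part.
pose h' (p : 'I_n * 'I_n) : 'I_n :=
  insubd p.1 (flatten_index (shape_of la) p.1 p.2).
exists h' => [k _|[r c]]; rewrite /h'.
  by apply: val_inj; rewrite val_insubd /= reshape_indexK ltn_ord.
rewrite inE /= => lc.
have := flatten_indexP lc; rewrite sumn_shape => kn.
by congr pair; apply: val_inj;
  rewrite /= /box_row /box_col val_insubd kn ?flatten_indexKl ?flatten_indexKr.
Qed.

Lemma sum_ltn_ord m a : (a <= m)%N -> (\sum_(c < m | (c < a)%N) 1 = a)%N.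
Proof. by move=> am; rewrite -(big_ord_widen _ (fun=> 1%N)) // sum1_card
  card_ord. Qed.

(** The number of boxes in the first [c] columns. Comparing it for all [c] is the dominance order on
    conjugate partitions. *)
Definition minsum c : nat := (\sum_(r < n) minn (part la r) c)%N.

Lemma card_col_lt c : #|[set k | (box_col la k < c)%N]| = minsum c.
Proof.
rewrite -sum1_card big_mkcond /=.
under eq_bigr => k _ do rewrite inE.
rewrite (sum_boxes (fun _ c' => if (c' < c)%N then 1%N else 0%N)).
apply: eq_bigr => r _; rewrite -big_mkcondr /=.
rewrite (eq_bigl (fun i : 'I_n => (i < minn (part la r) c)%N)) => [|i].
  by rewrite sum_ltn_ord // geq_min part_le.
by rewrite leq_min.
Qed.

Lemma card_row r : #|[set k | box_row la k == r]| = part la r.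
Proof.
have [nr|rn] := leqP n r.
  rewrite part_default //; apply: eq_card0 => k; rewrite !inE.
  by apply: ltn_eqF; apply: leq_trans nr; apply: box_row_lt.
rewrite -sum1_card big_mkcond /=.
under eq_bigr => k _ do rewrite inE.
rewrite (sum_boxes (fun r' _ => if r' == r then 1%N else 0%N)).
rewrite (bigD1 (Ordinal rn)) //= [X in _ + X]big1 => [|r']; last first.
  by rewrite -val_eqE /= => /negPf nr'; rewrite big1 // nr'.
by rewrite addr0 eqxx sum_ltn_ord // part_le.
Qed.

Lemma sum_same_row k :
  \sum_(i < n) nat_of_bool ((box_row la i == box_row la k) &&
                (box_col la i < box_col la k)%N) = box_col la k.
Proof.
rewrite (sum_boxes (fun r c => nat_of_bool
  ((r == box_row la k) && (c < box_col la k)%N))) /=.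
rewrite (bigD1 (Ordinal (box_row_lt k))) //= [X in _ + X]big1 => [|r'].
  rewrite addr0 eqxx -big_mkcondr /=.
  rewrite (eq_bigl (fun i : 'I_n => (i < box_col la k)%N)) => [|i].
    by rewrite sum_ltn_ord // ltnW // box_col_lt.
  by apply: andb_idl => /ltn_trans; apply; apply: box_col_lt_part.
by rewrite -val_eqE /= => /negPf nr'; rewrite big1 // nr'.
Qed.

Lemma sum_same_col k :
  \sum_(i < n) nat_of_bool ((box_col la i == box_col la k) &&
                (box_row la i < box_row la k)%N) = box_row la k.
Proof.
rewrite (sum_boxes (fun r c => nat_of_bool
  ((c == box_col la k) && (r < box_row la k)%N))) /=.
rewrite -[RHS](sum_ltn_ord (ltnW (box_row_lt k))) [RHS]big_mkcond.
apply: eq_bigr => r _; case: ltnP => rk; last first.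
  by rewrite big1 // => c _; rewrite andbF.
rewrite (bigD1 (Ordinal (box_col_lt k))) /=; last first.
  by apply: leq_trans (box_col_lt_part k) _; apply: part_homo; apply: ltnW.
rewrite eqxx [X in _ + X]big1 ?addr0 // => c /andP[_].
by rewrite -val_eqE /= => /negPf nc; rewrite nc.
Qed.

End Boxes.

Lemma part_inj n (la mu : intpart n) : part la =1 part mu -> la = mu.
Proof.
move=> e; apply: val_inj; apply: val_inj => /=.
apply: (inj_map val_inj); apply: (@eq_from_nth _ 0%N).
  by rewrite !size_map !size_tuple.
by move=> i _; apply: e.
Qed.

(** Successive differences are the column lengths, and these determine the rows. *)
Lemma minsum_inj n (la mu : intpart n) : minsum la =1 minsum mu -> la = mu.
Proof.
move=> e; apply: part_inj.
have col_card (nu : intpart n) c :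
    (minsum nu c.+1 = minsum nu c + #|[set r : 'I_n | (c < part nu r)%N]|)%N.
  rewrite /minsum -sum1_card [X in (_ + X)%N]big_mkcond -big_split /=.
  apply: eq_bigr => r _; rewrite inE.
  by case: (ltnP c (part nu r)) => h; lia.
have cardE c : #|[set r : 'I_n | (c < part la r)%N]| =
               #|[set r : 'I_n | (c < part mu r)%N]|.
  by apply/eqP; rewrite -(eqn_add2l (minsum la c)) -col_card e col_card e.
have lt_card (nu : intpart n) (r : 'I_n) c :
    (c < part nu r)%N = (r < #|[set r : 'I_n | (c < part nu r)%N]|)%N.
  apply/idP/idP => [cr|].
    rewrite -[X in (X <= _)%N](sum_ltn_ord (ltn_ord r)) sum1_card.
    apply: subset_leq_card; apply/subsetP => i; rewrite inE => ir.
    by have {}ir : (i <= r)%N := ir; apply: leq_trans cr (part_homo _ ir).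
  apply: contraTT; rewrite -leqNgt => rc; rewrite -leqNgt.
  rewrite -[X in (_ <= X)%N](sum_ltn_ord (ltnW (ltn_ord r))) sum1_card.
  apply: subset_leq_card; apply/subsetP => i; rewrite inE => ci.
  suff : (i < r)%N by [].
  rewrite ltnNge; apply: contraTN ci => ri; rewrite -leqNgt.
  by apply: leq_trans (part_homo _ ri) rc.
move=> r; have [nr|rn] := leqP n r; first by rewrite !part_default.
have lt_eq c : (c < part la r)%N = (c < part mu r)%N.
  by rewrite (lt_card la (Ordinal rn)) cardE -lt_card.
by have := lt_eq (part la r); have := lt_eq (part mu r); lia.
Qed.

(** * Rows of one tableau against columns of another *)

Section Tableaux.
Variables (n : nat) (la mu : intpart n) (g : 'S_n).

Definition row_col_separated :=
  forall i j, i != j -> box_row la i = box_row la j ->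
    box_col mu (g i) != box_col mu (g j).

Hypothesis sep : row_col_separated.

Let cells r c := [set k | (box_row la k == r) && (box_col mu (g k) < c)%N].

(** The boxes of one row land in distinct columns, so at most [c] of them land in the first [c]. *)
Lemma card_cells_le r c : (#|cells r c| <= minn (part la r) c)%N.
Proof.
rewrite leq_min; apply/andP; split.
  by rewrite -card_row subset_leq_card //; apply/subsetP => k;
    rewrite !inE => /andP[].
case: c => [|c].
  by rewrite leqn0; apply/eqP/eq_card0 => k; rewrite !inE ltn0 andbF.
rewrite -[X in (_ <= X)%N]card_ord.
have inj : {in cells r c.+1 &, injective (fun k => inord (box_col mu (g k)) :
  'I_c.+1)}.
  move=> k k'; rewrite !inE => /andP[/eqP er ec] /andP[/eqP er' ec'] e.
  apply/eqP; apply: contraTT isT => nk.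
  move/(congr1 val): e => /=; rewrite !inordK // => e.
  by have := sep nk (etrans er (esym er')); rewrite e eqxx.
by rewrite -(card_in_imset inj) max_card.
Qed.

Lemma sum_card_cells c : (\sum_(r < n) #|cells r c| = minsum mu c)%N.
Proof.
rewrite -card_col_lt -[in RHS](card_preimset _ (@perm_inj _ g)) -sum1_card.
rewrite [RHS](partition_big (fun k => Ordinal (box_row_lt la k)) xpredT) //=.
apply: eq_bigr => r _; rewrite -sum1_card; apply: eq_bigl => k.
by rewrite !inE -val_eqE /= andbC.
Qed.

Lemma minsum_le c : (minsum mu c <= minsum la c)%N.
Proof. by rewrite -sum_card_cells; apply: leq_sum => r _; apply: card_cells_le. Qed.

Lemma card_cells c (r : 'I_n) : minsum mu c = minsum la c ->
  #|cells r c| = minn (part la r) c.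
Proof.
move=> eqc; have := sum_card_cells c; rewrite eqc => /eqP.
have [|_ ->] := @leqif_sum 'I_n xpredT (fun i => #|cells i c| == minn (part la i) c)
  (fun i => #|cells i c|) (fun i => minn (part la i) c).
  by move=> i _; split => //; apply: card_cells_le.
by move/forallP/(_ r)/eqP.
Qed.

(** When the shapes agree, the bounds of [card_cells_le] have equal sums and are all equalities.
    Taking [c] to be the row length puts the whole row into the first [c] columns. *)
Lemma row_col_target k : la = mu -> (box_col mu (g k) < part la (box_row la k))%N.
Proof.
move=> elm; set r := Ordinal (box_row_lt la k); set c := part la r.
have eqm d : minsum mu d = minsum la d by rewrite elm.
have cE : #|cells r c| = c by rewrite card_cells ?eqm // minnn.
suff : k \in cells r c by rewrite inE => /andP[].
suff -> : cells r c = [set i | box_row la i == r] by rewrite inE.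
apply/eqP; rewrite eqEcard card_row cE leqnn andbT.
by apply/subsetP => i; rewrite !inE => /andP[].
Qed.

End Tableaux.

(** The factor [p] slides each box along its row to the column where [g] sends it, a position inside
    the diagram by [row_col_target]; what remains of [g] preserves columns. *)
Lemma row_col_decomp n (la : intpart n) (g : 'S_n) : row_col_separated la la g ->
  exists p q, [/\ p \in row_stab la, q \in col_stab la & g = (p * q)%g].
Proof.
move=> sep.
have /fin_all_exists2[p rp cp] k :
    exists2 i, box_row la i = box_row la k & box_col la i = box_col la (g k).
  exact/box_exists/row_col_target.
have p_inj : injective p.
  move=> i j pij; apply/eqP/contraT => nij.
  have rij : box_row la i = box_row la j by rewrite -rp pij rp.
  by have := sep _ _ nij rij; rewrite -!cp pij eqxx.
exists (perm p_inj), ((perm p_inj)^-1 * g)%g; split; last by rewrite mulKVg.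
  by rewrite inE; apply/forallP => k; rewrite permE rp.
rewrite inE; apply/forallP => k; rewrite permM -cp -{2}[k](permKV (perm p_inj)).
by rewrite permE.
Qed.

Section Stabilizers.
Variables (n : nat) (la : intpart n).

Lemma row_stabP (s : 'S_n) :
  reflect (forall k, box_row la (s k) = box_row la k) (s \in row_stab la).
Proof. by rewrite inE; apply: (iffP forallP) => h k; apply/eqP; rewrite h. Qed.

Lemma col_stabP (s : 'S_n) :
  reflect (forall k, box_col la (s k) = box_col la k) (s \in col_stab la).
Proof. by rewrite inE; apply: (iffP forallP) => h k; apply/eqP; rewrite h. Qed.

Lemma row_stab1 : 1%g \in row_stab la.
Proof. by apply/row_stabP => k; rewrite perm1. Qed.

Lemma col_stab1 : 1%g \in col_stab la.
Proof. by apply/col_stabP => k; rewrite perm1. Qed.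

Lemma row_stabM s t :
  s \in row_stab la -> t \in row_stab la -> (s * t)%g \in row_stab la.
Proof. by move=> /row_stabP rs /row_stabP rt; apply/row_stabP => k;
  rewrite permM rt rs. Qed.

Lemma col_stabM s t :
  s \in col_stab la -> t \in col_stab la -> (s * t)%g \in col_stab la.
Proof. by move=> /col_stabP rs /col_stabP rt; apply/col_stabP => k;
  rewrite permM rt rs. Qed.

Lemma row_stabV s : (s^-1 \in row_stab la)%g = (s \in row_stab la).
Proof.
apply/row_stabP/row_stabP => rs k; last by rewrite -{2}[k](permKV s) rs.
by rewrite -{2}[k](permK s) rs.
Qed.

Lemma col_stabV s : (s^-1 \in col_stab la)%g = (s \in col_stab la).
Proof.
apply/col_stabP/col_stabP => rs k; last by rewrite -{2}[k](permKV s) rs.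
by rewrite -{2}[k](permK s) rs.
Qed.

Lemma row_stabMl s t : s \in row_stab la ->
  (s * t \in row_stab la)%g = (t \in row_stab la).
Proof.
move=> rs; apply/idP/idP => [st|]; last exact: row_stabM.
by rewrite -[t](mulKg s) row_stabM ?row_stabV.
Qed.

Lemma col_stabMr s t : t \in col_stab la ->
  (s * t \in col_stab la)%g = (s \in col_stab la).
Proof.
move=> ct; apply/idP/idP => [st|cs]; last exact: col_stabM.
by rewrite -[s](mulgK t) col_stabM ?col_stabV.
Qed.

Lemma row_col_stab s : s \in row_stab la -> s \in col_stab la -> s = 1%g.
Proof.
move=> /row_stabP rs /col_stabP cs; apply/permP => k.
by rewrite perm1; apply: box_inj.
Qed.

Lemma tperm_row_stab i j :
  (tperm i j \in row_stab la) = (box_row la i == box_row la j).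
Proof.
apply/row_stabP/eqP => [/(_ i)|e k]; first by rewrite tpermL.
by case: tpermP => [->|->|].
Qed.

Lemma tperm_col_stab i j :
  (tperm i j \in col_stab la) = (box_col la i == box_col la j).
Proof.
apply/col_stabP/eqP => [/(_ i)|e k]; first by rewrite tpermL.
by case: tpermP => [->|->|].
Qed.

End Stabilizers.

(** * Young symmetrizers *)

Section Star.
Variables (C : numClosedFieldType) (gT : finGroupType).
Local Notation A := (galg C gT).
Implicit Types (x y : A) (g : gT).

Definition star x : A := [ffun g => (x g^-1%g)^*].

Lemma starE x g : star x g = (x g^-1%g)^*. Proof. exact: ffunE. Qed.

Lemma starK x : star (star x) = x.
Proof. by apply/galgP=> g; rewrite !starE invgK conjCK. Qed.

Lemma star0 : star 0 = 0.
Proof. by apply/galgP=> g; rewrite starE !ffunE conjC0. Qed.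

Lemma starM x y : star (x * y) = star y * star x.
Proof.
apply/galgP=> g; rewrite starE !gmulE rmorph_sum /=.
rewrite (reindex_inj (mulgI g^-1%g)) /=; apply: eq_bigr => h _.
by rewrite rmorphM /= !starE !invMg !invgK mulgK mulrC.
Qed.

Lemma starZ c x : star (c *: x) = c^* *: star x.
Proof. by apply/galgP=> g; rewrite gscaleE !starE gscaleE rmorphM. Qed.

Lemma star_gavg x : star (gavg x) = gavg (star x).
Proof.
apply/galgP=> g; rewrite starE !gsumE rmorph_sum; apply: eq_bigr => h _ /=.
by rewrite !gconjE starE conjVg.
Qed.

End Star.

Section Symmetrizer.
Variables (C : numClosedFieldType) (n : nat).
Implicit Types (la mu : intpart n) (g : 'S_n).
Local Notation A := (galg C 'S_n).

Definition row_sum la : A := [ffun g => (g \in row_stab la)%:R].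
Definition col_sum la : A := [ffun g => (g \in col_stab la)%:R * (-1) ^+ g].
Definition ysym la : A := row_sum la * col_sum la.

Lemma row_sumE la g : row_sum la g = (g \in row_stab la)%:R.
Proof. exact: ffunE. Qed.

Lemma col_sumE la g : col_sum la g = (g \in col_stab la)%:R * (-1) ^+ g.
Proof. exact: ffunE. Qed.

Lemma row_sumMl la p : p \in row_stab la -> gdelta p * row_sum la = row_sum la.
Proof.
by move=> rp; apply/galgP=> g; rewrite gdeltaMl !row_sumE row_stabMl ?row_stabV.
Qed.

Lemma col_sumMr la q : q \in col_stab la ->
  col_sum la * gdelta q = (-1) ^+ q *: col_sum la.
Proof.
move=> rp; apply/galgP=> g; rewrite gdeltaMr gscaleE !col_sumE.
by rewrite col_stabMr ?col_stabV // odd_permM odd_permV signr_addb [RHS]mulrC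
  -mulrA.
Qed.

Lemma star_row_sum la : star (row_sum la) = row_sum la.
Proof. by apply/galgP=> g; rewrite starE !row_sumE row_stabV conjC_nat. Qed.

Lemma star_col_sum la : star (col_sum la) = col_sum la.
Proof.
apply/galgP=> g; rewrite starE !col_sumE col_stabV odd_permV rmorphM /= conjC_nat.
by rewrite rmorph_sign.
Qed.

Lemma star_ysym la : star (ysym la) = col_sum la * row_sum la.
Proof. by rewrite starM star_row_sum star_col_sum. Qed.

Lemma ysym1 la : ysym la 1%g = 1.
Proof.
rewrite gmulE (bigD1 1%g) //= big1 => [|g ng].
  by rewrite row_sumE col_sumE invg1 mulg1 row_stab1 col_stab1 odd_perm1 !mul1r
    addr0.
rewrite row_sumE col_sumE mulg1 col_stabV; case rg: (g \in _);
  last by rewrite mul0r.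
case cg: (g \in _); last by rewrite mul0r mulr0.
by rewrite (row_col_stab rg cg) eqxx in ng.
Qed.

(** Two shapes are allowed: equal ones give primitivity of Young symmetrizers, different ones their
    orthogonality. *)
Definition row_col_inv la mu (x : A) :=
  (forall p, p \in row_stab la -> gdelta p * x = x) /\
  (forall q, q \in col_stab mu -> x * gdelta q = (-1) ^+ q *: x).

Lemma row_col_invM la mu x : row_col_inv la mu (row_sum la * x * col_sum mu).
Proof.
split=> [p rp|q cq]; first by rewrite !mulrA row_sumMl.
by rewrite -!mulrA col_sumMr // !scalerAr.
Qed.

Lemma ysym_inv la : row_col_inv la la (ysym la).
Proof. by have := row_col_invM la la 1; rewrite mulr1. Qed.

Section RowColInv.
Variables (la mu : intpart n) (x : A).
Hypothesis inv_x : row_col_inv la mu x.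

(** Multiplying [g] by [tperm i j] on the left equals multiplying it by [tperm (g i) (g j)] on the
    right; the first preserves the coefficient and the second negates it. *)
Lemma row_col_inv_eq0 g i j : i != j -> box_row la i = box_row la j ->
  box_col mu (g i) = box_col mu (g j) -> x g = 0.
Proof.
move=> nij rij cij; have [inv_l inv_r] := inv_x.
have tp : tperm i j \in row_stab la by rewrite tperm_row_stab rij.
have tq : tperm (g i) (g j) \in col_stab mu by rewrite tperm_col_stab cij.
have e1 : x g = x (tperm i j * g)%g.
  by rewrite -{2}(inv_l _ tp) gdeltaMl mulKg.
have e2 : x (tperm i j * g)%g = - x g.
  rewrite conjgC tpermJ.
  have := congr1 (fun y : A => y (g * tperm (g i) (g j))%g) (inv_r _ tq).
  rewrite gdeltaMr mulgK gscaleE odd_tperm (inj_eq perm_inj) nij expr1 mulN1r.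
  by move=> ->; rewrite opprK.
by apply/eqP; rewrite -eqNr -e2 -e1.
Qed.

Lemma row_col_inv_minsum c : x != 0 -> (minsum mu c <= minsum la c)%N.
Proof.
move=> nx; have [g ng] : exists g, x g != 0.
  apply/existsP; apply: contraNT nx => /existsPn x0; apply/eqP/galgP => g.
  by rewrite ffunE; apply/eqP/negPn/x0.
apply: (@minsum_le n la mu g) => i j nij rij.
by apply: contraNneq ng => cij; rewrite (row_col_inv_eq0 nij rij cij).
Qed.

End RowColInv.

(** Von Neumann's lemma. The coefficient at [g] vanishes when [g] puts two boxes of a row into one
    column; otherwise [g = p * q], and invariance reduces it to the sign of [q] times the
    coefficient at the identity. *)
Lemma row_col_inv_ysym la x : row_col_inv la la x -> x = x 1%g *: ysym la.
Proof.
move=> inv_x; apply/galgP=> g; rewrite gscaleE.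
have [/existsP[i /existsP[j /and3P[nij /eqP rij /eqP cij]]]|/existsPn sep] :=
  boolP [exists i, exists j, [&& i != j, box_row la i == box_row la j &
    box_col la (g i) == box_col la (g j)]].
  by rewrite !(@row_col_inv_eq0 la la _ _ g i j) ?mulr0 //; apply: ysym_inv.
have [|p [q [rp cq gE]]] := @row_col_decomp _ la g.
  move=> i j nij rij; have /existsPn/(_ j) := sep i.
  by rewrite nij rij eqxx.
have pqE y : row_col_inv la la y -> y g = (-1) ^+ q * y 1%g.
  case=> inv_l inv_r; rewrite gE -(inv_l _ rp) gdeltaMl mulKg.
  have := congr1 (fun z : A => z q) (inv_r _ cq).
  rewrite gdeltaMr mulgV gscaleE inv_l // => ->.
  by rewrite mulrA -signr_addb addbb mul1r.
by rewrite (pqE x) // (pqE (ysym la)) ?ysym1 ?mulr1 1?mulrC //; apply: ysym_inv.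
Qed.

Lemma ysym_primitive la : primitive (ysym la).
Proof.
split=> [|x]; first exact: ysym1.
exists ((ysym la * x * ysym la) 1%g); apply: row_col_inv_ysym.
rewrite /ysym !mulrA -(mulrA (row_sum la)) -(mulrA (row_sum la)) .
exact: row_col_invM.
Qed.

Lemma ysym_orth la mu x : la != mu -> ysym la * x * ysym mu = 0.
Proof.
move=> nlm; apply/eqP; apply: contraNT nlm => nx; apply/eqP/minsum_inj => c.
apply/eqP; rewrite eqn_leq; apply/andP; split.
  (* The reverse inequality comes from the inner factor [col_sum la * x * row_sum mu] of the
     product: its star is row-invariant for [mu] and column-alternating for [la]. *)
  pose y := row_sum mu * star x * col_sum la.
  apply: (@row_col_inv_minsum mu la y); first exact: row_col_invM.
  apply: contraNneq nx => y0; have: star y = col_sum la * x * row_sum mu.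
    by rewrite !starM starK star_row_sum star_col_sum mulrA.
  rewrite y0 star0 /ysym !mulrA -(mulrA (row_sum la)) -(mulrA (row_sum la)).
  by move<-; rewrite mulr0 mul0r.
apply: row_col_inv_minsum nx.
rewrite /ysym !mulrA -(mulrA (row_sum la)) -(mulrA (row_sum la)).
exact: row_col_invM.
Qed.

End Symmetrizer.

(** * Contents *)

Section AddBox.
Variable n : nat.
Implicit Types (be : intpart n) (nu : intpart n.+1).

Lemma add_row_lt be nu r : (forall i, part nu i = (part be i + (i == r))%N) ->
  (r < n.+1)%N.
Proof.
move=> h; rewrite ltnNge; apply/negP => nr; have := h r.
by rewrite part_default // eqxx addn1.
Qed.

Lemma adds_boxP be nu :
  reflect (exists r : nat, forall i, part nu i = (part be i + (i == r))%N)
          (adds_box be nu).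
Proof.
apply: (iffP existsP) => [[r /forallP h]|[r h]].
  exists r => i; have [ni|] := leqP n.+1 i; last first.
    by move=> lin; apply/eqP: (h (Ordinal lin)).
  rewrite !part_default //; last exact: ltnW.
  by rewrite gtn_eqF // (leq_trans (ltn_ord r)).
have rn := add_row_lt h.
by exists (Ordinal rn); apply/forallP => i; apply/eqP/h.
Qed.

Lemma new_rowE be nu r : (forall i, part nu i = (part be i + (i == r))%N) ->
  new_row nu be = r.
Proof.
move=> h; have rn := add_row_lt h.
pose P i := part nu i != part be i.
have PE i : P i = (i == r).
  rewrite /P h; case: (i =P r) => _; first by rewrite addn1 gtn_eqF.
  by rewrite addn0 eqxx.
have hasP : has P (iota 0 n.+1).
  by apply/hasP; exists r; rewrite ?PE ?eqxx // mem_iota.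
have lt_find : (find P (iota 0 n.+1) < n.+1)%N by rewrite -{2}(size_iota 0 n.+1)
  -has_find.
by have := nth_find 0%N hasP; rewrite PE nth_iota // add0n => /eqP.
Qed.

Lemma skew_contentE be nu r :
  (forall i, part nu i = (part be i + (i == r))%N) ->
  skew_content nu be = (part be r)%:Z - r%:Z.
Proof. by move=> h; rewrite /skew_content (new_rowE h). Qed.

End AddBox.

Definition total_content n (la : intpart n) : int :=
  \sum_(k < n) ((box_col la k)%:Z - (box_row la k)%:Z).

Lemma total_contentE n (la : intpart n) N : (n <= N)%N ->
  total_content la =
  \sum_(0 <= r < N) \sum_(0 <= c < part la r) (c%:Z - r%:Z).
Proof.
move=> nN; rewrite /total_content (sum_boxes la (fun r c => c%:Z - r%:Z)).
rewrite (big_cat_nat (n := n)) //= [X in _ + X]big_nat_cond.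
rewrite [X in _ + X]big1 ?addr0 => [|r /andP[/andP[nr _] _]]; last first.
  by rewrite part_default // big_geq.
rewrite big_mkord; apply: eq_bigr => r _.
by rewrite big_mkord (big_ord_widen _ (fun c : nat => c%:Z - r%:Z) (part_le la r)).
Qed.

Lemma total_content_add n (be : intpart n) (nu : intpart n.+1) :
  adds_box be nu -> total_content nu = total_content be + skew_content nu be.
Proof.
case/adds_boxP=> r h; rewrite (skew_contentE h).
have rn := add_row_lt h.
rewrite (total_contentE nu (leqnn _)) (total_contentE be (leqnSn _)) !big_mkord.
rewrite [LHS](bigD1 (Ordinal rn)) // [in RHS](bigD1 (Ordinal rn)) //=.
rewrite h eqxx addn1 big_nat_recr //= addrAC; congr (_ + _ + _).
apply: eq_bigr => i.
by rewrite -val_eqE /= h => /negPf->; rewrite addn0.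
Qed.

(** Two boxes added in succession never lie on one diagonal: a higher row gives a larger content, a
    lower row a smaller one, and in the same row the contents differ by 1. *)
Lemma skew_content_neq n (ga : intpart n) (be : intpart n.+1)
    (nu : intpart n.+2) : adds_box ga be -> adds_box be nu ->
  skew_content nu be - skew_content be ga != 0.
Proof.
case/adds_boxP=> r0 h0 /adds_boxP[r h].
rewrite (skew_contentE h) (skew_contentE h0).
have b0 := h0 r0; rewrite eqxx in b0.
case: (ltngtP r r0) => rr.
- have := part_homo be (ltnW rr); lia.
- have := h r; rewrite eqxx => hr.
  have := part_homo nu (leq_pred r); rewrite hr (h r.-1).
  have -> : (r.-1 == r) = false by lia.
  have := part_homo be (_ : r0 <= r.-1)%N; lia.
- subst r; lia.
Qed.

Section Transpositions.
Variables (C : numClosedFieldType) (n : nat).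
Implicit Types (la : intpart n) (g : 'S_n).
Local Notation A := (galg C 'S_n).

(* Twice the sum of all transpositions. *)
Definition tperm_sum : A := \sum_(i < n) \sum_(j < n | i != j) gdelta (tperm i j).

Lemma tperm_sum_central : gcentral tperm_sum.
Proof.
apply: gcentralP => g; suff e : gconj g tperm_sum = tperm_sum.
  by rewrite -{1}e /gconj -mulrA gdeltaVK mulr1.
rewrite /gconj mulr_sumr mulr_suml [RHS](reindex_inj (@perm_inj _ g^-1)%g).
apply: eq_bigr => i _.
rewrite mulr_sumr mulr_suml [RHS](reindex_inj (@perm_inj _ g^-1)%g).
apply: eq_big => j; first by rewrite (inj_eq perm_inj).
by move=> _; rewrite -/(gconj _ _) gconj_gdelta tpermJ.
Qed.

Lemma ysym_tperm la i j : i != j ->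
  ysym C la (tperm i j) =
  (box_row la i == box_row la j)%:R - (box_col la i == box_col la j)%:R.
Proof.
move=> nij; have inv := ysym_inv C la.
case: (eqVneq (box_row la i)) => [rij|nrij].
  case: eqVneq => [cij|_]; first by rewrite (box_inj rij cij) eqxx in nij.
  rewrite subr0 -(inv.1 (tperm i j)) ?tperm_row_stab ?rij //.
  by rewrite gdeltaMl mulVg ysym1.
case: eqVneq => [cij|ncij].
  have := congr1 (fun x : A => x 1%g) (inv.2 (tperm i j) _).
  rewrite tperm_col_stab cij eqxx gdeltaMr gscaleE ysym1 odd_tperm nij => /(_ isT).
  by rewrite mul1g tpermV => ->; rewrite mulr1 expr1 sub0r.
rewrite subr0.
wlog ltr : i j nij nrij ncij / (box_row la i < box_row la j)%N => [wl|].
  case: (ltngtP (box_row la i) (box_row la j)) nrij => // lt _.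
    by apply: wl => //; rewrite ltn_eqF.
  by rewrite tpermC; apply: wl; rewrite // 1?eq_sym // gtn_eqF.
(* The box in the row of [i] and the column of [j] exists because [i] lies in the higher row. The
   transposition fixes it and moves [i] to [j], so two boxes of one row get into one column. *)
have [k rk ck] : exists2 k, box_row la k = box_row la i & box_col la k = box_col
  la j.
  by apply: box_exists; apply: leq_trans (box_col_lt_part la j) (part_homo _
    (ltnW ltr)).
have ki : k != i by apply: contraNneq ncij => <-; rewrite ck.
have kj : k != j by apply: contraNneq nrij => <-; rewrite rk.
by apply: (row_col_inv_eq0 inv ki rk); rewrite tpermL tpermD 1?eq_sym.
Qed.

(** Ordered pairs in a common row are twice the pairs with a marked box and a box to its left, and
    the boxes to its left number its column index; likewise for columns. *)
Lemma sum_ysym_tperm la :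
  \sum_(i < n) \sum_(j < n | i != j) ysym C la (tperm i j) =
  (2 * total_content la)%:~R.
Proof.
pose lt2 (f h : 'I_n -> nat) i j := nat_of_bool ((f i == f j) && (h i < h j)%N).
have split2 (f h : 'I_n -> nat) : (forall i j, f i = f j -> h i = h j -> i = j) ->
    (\sum_i \sum_(j | i != j) (f i == f j) = 2 * \sum_j \sum_i lt2 f h i j)%N.
  move=> inj; rewrite mul2n -addnn [X in (_ = _ + X)%N]exchange_big -big_split.
  apply: eq_bigr => i _; rewrite big_mkcond -big_split; apply: eq_bigr => j _ /=.
  rewrite /lt2 [f j == _]eq_sym; case: (eqVneq i j) => [->|nij].
    by rewrite ltnn andbF.
  case: eqVneq => //= fij; case: ltngtP => // hij.
  by rewrite (inj _ _ fij (esym hij)) eqxx in nij.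
have e : \sum_(i < n) \sum_(j < n | i != j) ysym C la (tperm i j) =
  (\sum_i \sum_(j | i != j) (box_row la i == box_row la j))%N%:R -
  (\sum_i \sum_(j | i != j) (box_col la i == box_col la j))%N%:R.
  rewrite !natr_sum -sumrB; apply: eq_bigr => i _.
  rewrite !natr_sum -sumrB; apply: eq_bigr => j; exact: ysym_tperm.
rewrite e (split2 _ (box_col la)) ?(split2 (box_col la) (box_row la)); first last.
- by move=> i j; apply: box_inj.
- by move=> i j ec er; apply: (box_inj er ec).
rewrite /lt2.
under eq_bigr => j _ do rewrite (sum_same_row la).
under [X in _ - (2 * X)%:R]eq_bigr => j _ do rewrite (sum_same_col la).
rewrite /total_content sumrB !natrM -mulrBr rmorphM /=; congr (_ * _).
by rewrite rmorphB /= !rmorph_sum.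
Qed.

Lemma zid_tperm_sum la : tperm_sum * zid (ysym C la) =
  (2 * total_content la)%:~R *: zid (ysym C la).
Proof.
apply: zid_eigen; first exact: tperm_sum_central.
rewrite (prim_central (ysym_primitive C la) tperm_sum_central).
rewrite -sum_ysym_tperm; congr (_ *: _).
rewrite mulr_suml gsumE; apply: eq_bigr => i _.
rewrite mulr_suml gsumE; apply: eq_bigr => j _.
by rewrite gdeltaMl tpermV mulg1.
Qed.

End Transpositions.

(** * Adding and removing boxes in Young's lattice *)

Section UpDown.
Local Open Scope nat_scope.

Lemma sum_part n (la : intpart n) : \sum_(i < n) part la i = n.
Proof.
by rewrite -[RHS](sumn_shape la) sumnE (big_nth 0) size_shape big_mkord.
Qed.

Lemma intpart_exists n (f : nat -> nat) : (forall i, f i.+1 <= f i) ->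
  (forall i, n <= i -> f i = 0) -> \sum_(i < n) f i = n ->
  exists la : intpart n, part la =1 f.
Proof.
move=> f_dec f0 sum_f.
have f_le i : f i <= n.
  have [ni|lin] := leqP n i; first by rewrite f0.
  by rewrite -[X in _ <= X]sum_f (bigD1 (Ordinal lin)) //= leq_addr.
pose t := [tuple (inord (f i) : 'I_n.+1) | i < n].
have rowsE : rows t = mkseq f n.
  apply: (@eq_from_nth _ 0) => [|i]; rewrite size_map size_tuple ?size_mkseq //.
  move=> lin; rewrite (nth_map ord0) ?size_tuple // nth_mkseq //.
  have := tnth_nth ord0 t (Ordinal lin); rewrite tnth_mktuple /= => <-.
  by rewrite inordK // ltnS.
have t_part : is_intpart t.
  rewrite /is_intpart rowsE; apply/andP; split; last first.
    by rewrite -{2}sum_f -(big_mkord xpredT f) /index_iota subn0 sumnE big_map.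
  apply/(sortedP 0) => i; rewrite size_mkseq => lin.
  by rewrite /= !nth_mkseq ?f_dec // ltnW.
exists (IntPart t_part) => i; rewrite /part /shape_of /= rowsE.
have [ni|lin] := leqP n i; last by rewrite nth_mkseq.
by rewrite nth_default ?size_mkseq ?f0.
Qed.

Lemma add_box_exists n (be : intpart n) r :
  (r == 0) || (part be r < part be r.-1) ->
  exists nu : intpart n.+1, forall i, part nu i = part be i + (i == r).
Proof.
move=> hr; have rn : r < n.+1.
  case/orP: hr => [/eqP->//|hr]; rewrite ltnNge; apply/negP => nr.
  by move: hr; rewrite !part_default //; lia.
apply: intpart_exists => [i|i ni|].
- have := part_homo be (leqnSn i).
  by case: (i.+1 =P r) hr => [<-|] /=; case: (i =P r) => /=; lia.
- by rewrite part_default; lia.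
- rewrite big_split /= big_ord_recr /= sum_part part_default // addn0.
  rewrite (bigD1 (Ordinal rn)) //= eqxx big1 ?addn0 ?addn1 // => i.
  by rewrite -val_eqE /= => /negPf->.
Qed.

Lemma adds_box_new_row n (be : intpart n) (nu : intpart n.+1) :
  adds_box be nu ->
  forall i, part nu i = part be i + (i == new_row nu be).
Proof. by case/adds_boxP=> r h i; rewrite (new_rowE h). Qed.

(** A box removable from row [r] makes row [r.+1] addable; row 0 is always addable and is not
    reached in this way. *)
Lemma card_removable n (be : intpart n) :
  #|[set ga : intpart n.-1 | adds_box ga be]| <
  #|[set nu : intpart n.+1 | adds_box be nu]|.
Proof.
have [nu0 nu0E] := @add_box_exists n be 0 isT.
have nu0in : nu0 \in [set nu : intpart n.+1 | adds_box be nu].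
  by rewrite inE; apply/adds_boxP; exists 0.
(* For [n = 0] the predecessor is 0 again, but [adds_box] then has no row to choose, so nothing is
   removable. *)
case: n be nu0 nu0E nu0in => [|n] be nu0 nu0E nu0in.
  apply: (@leq_trans 1); last by apply/card_gt0P; exists nu0.
  rewrite ltnS leqn0; apply/eqP/eq_card0 => ga.
  by rewrite !inE; apply/existsP => -[[]].
have /fin_all_exists[h hP] (ga : intpart n) : exists nu : intpart n.+2,
    adds_box ga be ->
    adds_box be nu /\ new_row nu be = (new_row be ga).+1.
  case ga_be: (adds_box ga be); last by exists nu0.
  have gaE := adds_box_new_row ga_be; set r := new_row be ga in gaE *.
  have [|nu nuE] := @add_box_exists _ be r.+1.
    rewrite /= !gaE eqxx; have := part_homo ga (leqnSn r); lia.
  exists nu => _; split; last exact: new_rowE nuE.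
  by apply/adds_boxP; exists r.+1.
pose D := [set ga : intpart n | adds_box ga be].
have h_inj : {in D &, injective h}.
  move=> ga ga'; rewrite !inE => ga_be ga'_be eh.
  have [_ e1] := hP _ ga_be; have [_ e2] := hP _ ga'_be.
  apply: part_inj => i; apply/eqP; rewrite -(eqn_add2r (i == new_row be ga)).
  rewrite -(adds_box_new_row ga_be); rewrite eh e2 in e1; case: e1 => <-.
  by rewrite -(adds_box_new_row ga'_be).
rewrite -(card_in_imset h_inj); apply: (@leq_trans #|nu0 |: h @: D|).
  rewrite cardsU1; have -> // : nu0 \notin h @: D.
  apply/imsetP => -[ga]; rewrite !inE => ga_be e0; have [_ e1] := hP _ ga_be.
  by rewrite -e0 (new_rowE nu0E) in e1.
apply/subset_leq_card/subsetP => nu /setU1P[->//|/imsetP[ga]].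
by rewrite !inE => ga_be ->; have [] := hP _ ga_be.
Qed.

(** For distinct shapes a common shape below can only be their intersection, and if it exists, the
    union is a common shape above. *)
Lemma card_down_up n (be be' : intpart n) :
  (be == be') +
  #|[set ga : intpart n.-1 | adds_box ga be && adds_box ga be']| <=
  #|[set nu : intpart n.+1 | adds_box be nu && adds_box be' nu]|.
Proof.
case: eqVneq => [<-|nbe].
  rewrite add1n (eq_card (B := [set ga : intpart n.-1 | adds_box ga be])).
    rewrite [X in _ < X](eq_card (B := [set nu : intpart n.+1 | adds_box be nu])).
      exact: card_removable.
    by move=> nu; rewrite !inE andbb.
  by move=> ga; rewrite !inE andbb.
rewrite add0n; case: n be be' nbe => [|n] be be' nbe.
  rewrite eq_card0 // => ga; rewrite !inE /=; apply/negP => /andP[].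
  by rewrite /adds_box => /existsP[[]].
set D := [set ga | _]; set U := [set nu | _].
case: (set_0Vmem D) => [->|[ga]]; first by rewrite cards0.
rewrite inE => /andP[ga_be ga_be'].
have beE := adds_box_new_row ga_be; have be'E := adds_box_new_row ga_be'.
set r := new_row be ga in beE; set r' := new_row be' ga in be'E.
have nrr : r != r'.
  by apply: contraNneq nbe => err; apply/eqP/part_inj => i; rewrite beE be'E err.
have U1 : 0 < #|U|.
  have [|nu nuE] := @add_box_exists _ be r'.
    case: (r' =P 0) => //= r'0; rewrite !beE (eq_sym r') (negPf nrr).
    have := part_homo be' (leq_pred r'); rewrite !be'E eqxx.
    have -> : (r'.-1 == r') = false by lia.
    by lia.
  apply/card_gt0P; exists nu; rewrite /U inE; apply/andP; split.
    by apply/adds_boxP; exists r'.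
  apply/adds_boxP; exists r => i; rewrite nuE beE be'E; lia.
apply: leq_trans U1; apply/card_le1_eqP => ga1 ga2.
have minE (ga' : intpart n) : ga' \in D ->
    forall i, part ga' i = minn (part be i) (part be' i).
  rewrite inE => /andP[g_be g_be'] i.
  have e1 := adds_box_new_row g_be i; have e2 := adds_box_new_row g_be' i.
  move: e1 e2; set s := new_row be ga'; set s' := new_row be' ga' => e1 e2.
  have nss : s != s'.
    apply: contraNneq nbe => ess; apply/eqP/part_inj => j.
    by rewrite (adds_box_new_row g_be) (adds_box_new_row g_be') -/s -/s' ess.
  rewrite e1 e2; case: (i =P s) => [->|_] /=.
    by rewrite (negPf nss) addn0; apply/esym/minn_idPr/leq_addr.
  by rewrite addn0; apply/esym/minn_idPl/leq_addr.
by move=> /minE e1 /minE e2; apply: part_inj => i; rewrite e1 e2.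
Qed.

(* [DU - UD = 1] on Young's lattice, as an inequality. *)
Lemma sum_down_up n (f : intpart n -> nat) (be : intpart n) :
  f be + \sum_(ga : intpart n.-1 | adds_box ga be)
           \sum_(be' : intpart n | adds_box ga be') f be' <=
  \sum_(nu : intpart n.+1 | adds_box be nu)
           \sum_(be' : intpart n | adds_box be' nu) f be'.
Proof.
rewrite (exchange_big_dep xpredT) //= [X in _ <= X](exchange_big_dep xpredT) //=.
have -> : f be = \sum_be' (be == be') * f be'.
  rewrite (bigD1 be) //= eqxx mul1n big1 ?addn0 // => b.
  by rewrite eq_sym => /negPf->.
rewrite -big_split; apply: leq_sum => be' _ /=.
rewrite !sum_nat_const -mulnDl leq_mul2r; apply/orP; right.
by have := card_down_up be be'; rewrite !cardsE.
Qed.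

End UpDown.

(** * The branching rule *)

Section Lift.
Variables (C : numClosedFieldType) (n : nat).
Implicit Types (s t : 'S_n).
Local Notation A := (galg C 'S_n).
Local Notation B := (galg C 'S_n.+1).

Definition lft s : 'S_n.+1 := lift_perm ord_max ord_max s.

Lemma lftM s t : lft (s * t) = (lft s * lft t)%g.
Proof. by rewrite /lft lift_permM. Qed.

Lemma lft1 : lft 1 = 1%g. Proof. exact: lift_perm1. Qed.

Lemma lftV s : lft s^-1 = (lft s)^-1%g. Proof. by rewrite /lft lift_permV. Qed.

Lemma lft_inj : injective lft.
Proof.
move=> s t est; apply/permP => k; apply: (@lift_inj _ ord_max).
by rewrite -!(lift_perm_lift ord_max) -/(lft s) est.
Qed.

Lemma odd_lft s : odd_perm (lft s) = odd_perm s.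
Proof. by rewrite odd_lift_perm addbb. Qed.

Definition galift (x : A) : B := \sum_s x s *: gdelta (lft s).

Lemma galift_is_linear : linear galift.
Proof.
move=> c x y; rewrite scaler_sumr -big_split; apply: eq_bigr => s _ /=.
by rewrite gaddE gscaleE scalerDl scalerA.
Qed.

HB.instance Definition _ := GRing.isLinear.Build C A B *:%R galift galift_is_linear.

Lemma galift_gdelta s : galift (gdelta s) = gdelta (lft s).
Proof.
rewrite /galift (bigD1 s) //= gdeltaE eqxx scale1r big1 ?addr0 // => t /negPf nts.
by rewrite gdeltaE nts scale0r.
Qed.

Lemma galift1 : galift 1 = 1.
Proof. by rewrite -gdelta1 galift_gdelta lft1. Qed.

Lemma galiftM x y : galift (x * y) = galift x * galift y.
Proof.
rewrite (galg_sum x) mulr_suml !linear_sum mulr_suml; apply: eq_bigr => s _.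
rewrite (galg_sum y) mulr_sumr !linear_sum mulr_sumr; apply: eq_bigr => t _.
by rewrite -scalerAr -scalerAl !linearZ /= -scalerAr -scalerAl -gdeltaM
  !galift_gdelta lftM gdeltaM.
Qed.

Lemma galift_coef x s : galift x (lft s) = x s.
Proof.
rewrite gsumE (bigD1 s) //= big1 => [|t nts].
  by rewrite gscaleE gdeltaE eqxx mulr1 addr0.
by rewrite gscaleE gdeltaE (inj_eq lft_inj) eq_sym (negPf nts) mulr0.
Qed.

Lemma galift_coef1 x : galift x 1%g = x 1%g.
Proof. by rewrite -lft1 galift_coef. Qed.

Lemma star_galift x : star (galift x) = galift (star x).
Proof.
apply/galgP=> g; rewrite starE !gsumE rmorph_sum (reindex_inj invg_inj) /=.
apply: eq_bigr => s _; rewrite !gscaleE !gdeltaE rmorphM /= conjC_nat starE.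
by rewrite lftV (inj_eq invg_inj).
Qed.

Lemma galift_gconj g x : galift (gconj g x) = gconj (lft g) (galift x).
Proof. by rewrite /gconj !galiftM !galift_gdelta lftV. Qed.

(** Conjugation by the smaller group fixes [z] and the coefficient at the identity, so all summands
    of the average contribute equally. *)
Lemma coef1_central_gavg (z : B) (x : A) : gcentral z ->
  (z * galift (gavg x)) 1%g = n`!%:R * (z * galift x) 1%g.
Proof.
move=> cz; rewrite linear_sum /= mulr_sumr gsumE.
rewrite (eq_bigr (fun=> (z * galift x) 1%g)) => [|g _].
  rewrite sumr_const mulr_natl; congr (_ *+ _).
  by rewrite -card_Sn; apply: eq_card.
have e1 (y : B) : gconj (lft g) y 1%g = y 1%g by rewrite gconjE conj1g.
rewrite galift_gconj -[RHS]e1 gconj_mul.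
by rewrite [in gconj _ z]/gconj -[gdelta _ * z]cz -mulrA gdeltaK mulr1.
Qed.

End Lift.

Section Branching.
Variables (C : numClosedFieldType) (n : nat).
Implicit Types (be : intpart n) (nu : intpart n.+1).
Local Notation e_ la := (ysym C la).
Local Notation z_ la := (zid (ysym C la)).
Local Notation kap_ la := (kap (ysym C la)).
Local Notation J := (@galift C n).

(** The row-by-row numberings of the two diagrams disagree after the new box. Conjugating by [g],
    which matches boxes by coordinates, carries the stabilizers of [be] into those of [nu]. *)
Lemma compatible_numbering be nu : adds_box be nu -> exists g : 'S_n.+1,
  (forall k, box_row nu (g (lift ord_max k)) = box_row be k) /\
  (forall k, box_col nu (g (lift ord_max k)) = box_col be k).
Proof.
case/adds_boxP=> r nuE.
have /fin_all_exists2[h hr hc] (k : 'I_n) : exists2 i,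
    box_row nu i = box_row be k & box_col nu i = box_col be k.
  by apply: box_exists; rewrite nuE ltn_addr // box_col_lt_part.
have [i0 i0r i0c] : exists2 i, box_row nu i = r & box_col nu i = part be r.
  by apply: box_exists; rewrite nuE eqxx addn1.
pose g i := if unlift ord_max i is Some k then h k else i0.
have h_i0 k : h k != i0.
  apply/eqP => e; have := box_col_lt_part be k.
  by rewrite -hc -hr e i0r i0c ltnn.
have g_inj : injective g.
  move=> i j; rewrite /g; case: unliftP => [k|] ->; case: unliftP => [k'|] -> //.
  - move=> e; congr (lift _ _); apply: (@box_inj _ be).
      by rewrite -hr e hr.
    by rewrite -hc e hc.
  - by move=> e; case/eqP: (h_i0 k).
  - by move=> e; case/eqP: (h_i0 k').
by exists (perm g_inj); split=> k; rewrite permE /g liftK.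
Qed.

Lemma ysym_conj_sq be : col_sum C be * row_sum C be * (col_sum C be * row_sum C be)
  = kap_ be *: (col_sum C be * row_sum C be).
Proof.
rewrite -star_ysym -starM (prim_sq (ysym_primitive C be)) starZ; congr (_ *: _).
by apply/CrealP/gtr0_real/kap_real_gt0/ysym_primitive.
Qed.

(** With [a], [b] the row and column sums of [nu] and [a'], [b'] the transported ones of [be],
    vanishing would give [a * b * a' * b' = 0]. Since [a] absorbs [a'] and [b] absorbs [b'] up to
    nonzero scalars, the square of the Young symmetrizer of [nu] would vanish. *)
Lemma zid_galift_neq0 be nu : adds_box be nu -> J (e_ be) * z_ nu != 0.
Proof.
move=> /compatible_numbering[g [gr gc]]; apply/eqP => Jz0.
pose a := row_sum C nu; pose b := col_sum C nu.
pose L x := gconj g^-1%g (J x).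
have LM x y : L (x * y) = L x * L y by rewrite /L galiftM gconj_mul.
pose a' := L (row_sum C be); pose b' := L (col_sum C be).
have g_lft (f : intpart n -> 'I_n -> nat) (f' : 'I_n.+1 -> nat) (p : 'S_n) :
    (forall k, f' (g (lift ord_max k)) = f be k) -> (forall k, f be (p k) = f be
      k) ->
    forall k, f' ((lft p ^ g)%g k) = f' k.
  move=> ff' fp k; rewrite -[k](permKV g) permJ; move: (g^-1%g k) => {}k.
  case: (unliftP ord_max k) => [i|] ->; last by rewrite lift_perm_id.
  by rewrite lift_perm_lift !ff'.
have LE x : L x = \sum_s x s *: gdelta (lft s ^ g)%g.
  rewrite /L /galift /gconj mulr_sumr mulr_suml; apply: eq_bigr => s _.
  by rewrite -scalerAr -scalerAl -/(gconj _ _) gconj_gdelta invgK.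
have a'a : a' * a = #|row_stab be|%:R *: a.
  rewrite /a' LE mulr_suml -sumr_const scaler_suml [RHS]big_mkcond.
  apply: eq_bigr => s _; rewrite row_sumE; case: ifP => rs;
    last by rewrite scale0r mul0r.
  rewrite !scale1r row_sumMl //; apply/row_stabP.
  by apply: (g_lft (@box_row n) (box_row nu)) => //; apply/row_stabP.
have bb' : b * b' = #|col_stab be|%:R *: b.
  rewrite /b' LE mulr_sumr -sumr_const scaler_suml [RHS]big_mkcond.
  apply: eq_bigr => s _; rewrite col_sumE; case: ifP => cs;
    last by rewrite mul0r scale0r mulr0.
  rewrite -scalerAr col_sumMr; last first.
    apply/col_stabP; apply: (g_lft (@box_col n) (box_col nu)) => //;
      exact/col_stabP.
  by rewrite odd_permJ odd_lft scalerA mul1r -signr_addb addbb.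
have ba'ba' : b' * a' * (b' * a') = kap_ be *: (b' * a').
  by rewrite /a' /b' -!LM ysym_conj_sq /L linearZ /= /gconj -scalerAr -scalerAl.
have aba'b' : a * b * (a' * b') = 0.
  have -> : a' * b' = gdelta g^-1 * J (e_ be) * gdelta g.
    by rewrite -LM /L /gconj invgK.
  have zc := @zid_central _ _ (ysym C nu).
  rewrite -[a * b]/(ysym C nu) -(prim_zid (ysym_primitive C nu)) -(mulrA _ (z_
    nu)) zc !mulrA.
  by rewrite -(mulrA _ _ (z_ nu)) -zc !mulrA -(mulrA _ (J _)) Jz0 mulr0 mul0r.
have k0 : kap_ be != 0 by apply/kap_neq0/ysym_primitive.
have card0 (S : {set 'S_n}) : 1%g \in S -> #|S|%:R != 0 :> C.
  by move=> S1; rewrite pnatr_eq0 -lt0n; apply/card_gt0P; exists 1%g.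
clearbody a' b'.
(* The trailing [b'] is removed by appending [a'] and inserting a [b'] absorbed by [b]: then
   [b' * a' * b' * a'] collapses to a multiple of [b' * a']. *)
have aba' : a * b * a' = 0.
  have: a * (b * b') * (a' * b' * a') = 0.
    by rewrite bb' -scalerAr -scalerAl (mulrA (a * b)) aba'b' mul0r scaler0.
  rewrite -!mulrA (mulrA b' a') ba'ba' -!scalerAr.
  move/eqP; rewrite scaler_eq0 (negPf k0) /= => /eqP; rewrite (mulrA b) bb'.
  rewrite -scalerAl -scalerAr => /eqP; rewrite scaler_eq0 (negPf (card0 _ _)) //=.
    by rewrite mulrA => /eqP.
  exact: col_stab1.
have aba : a * b * a = 0.
  apply/eqP; rewrite -(inj_eq (scalerI (card0 _ (row_stab1 be)))) scaler0.
  by rewrite scalerAr -a'a mulrA aba' mul0r.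
have := prim_sq (ysym_primitive C nu); rewrite /ysym -/a -/b mulrA aba mul0r.
move/esym/eqP; rewrite scaler_eq0 (negPf (kap_neq0 (ysym_primitive C nu))) /=.
move/eqP/(congr1 (fun x : galg C 'S_n.+1 => x 1%g)).
by rewrite -/(ysym C nu) ysym1 ffunE => /eqP; rewrite oner_eq0.
Qed.

End Branching.

Section Dimension.
Variables (C : numClosedFieldType) (n : nat).
Implicit Types (la mu : intpart n).

Definition specht_dim la : nat := \rank (lmul_mx (ysym C la)).

Lemma fact_kap la : n`!%:R = kap (ysym C la) * (specht_dim la)%:R.
Proof. by rewrite -card_kap ?card_Sn //; apply: ysym_primitive. Qed.

Lemma specht_dim_gt0 la : (0 < specht_dim la)%N.
Proof.
rewrite lt0n; apply: contraTneq (fact_gt0 n) => d0; have := fact_kap la.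
by rewrite d0 mulr0 -leqNgt leqn0 => /eqP; rewrite pnatr_eq0.
Qed.

Lemma kap_zid1 la : kap (ysym C la) * zid (ysym C la) 1%g = (specht_dim la)%:R.
Proof.
have k0 := kap_neq0 (ysym_primitive C la).
rewrite (zid1E (ysym_primitive C la)) card_Sn (fact_kap la).
by field.
Qed.

Lemma zid_ysym_orth la mu : la != mu -> zid (ysym C la) * zid (ysym C mu) = 0.
Proof. by move=> nlm; apply: zid_orth => x; apply: ysym_orth. Qed.

Lemma zid_sum_mul la : (\sum_mu zid (ysym C mu)) * zid (ysym C la) = zid (ysym C
  la).
Proof.
rewrite mulr_suml (bigD1 la) //= zidK ?big1 ?addr0 // => [mu nml|].
  exact: zid_ysym_orth.
exact: ysym_primitive.
Qed.

Lemma zid_compl_idem (y := 1 - \sum_(la : intpart n) zid (ysym C la)) : y * y = y.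
Proof.
rewrite /y mulrBr mulr1 [X in _ - X](_ : _ = 0) ?subr0 // mulr_sumr big1 // => la _.
by rewrite mulrBl mul1r zid_sum_mul subrr.
Qed.

End Dimension.

Section Restriction.
Variables (C : numClosedFieldType) (n : nat).
Implicit Types (be : intpart n) (nu : intpart n.+1) (Q : galg C 'S_n).
Local Notation z_ la := (zid (ysym C la)).
Local Notation kap_ la := (kap (ysym C la)).
Local Notation dim_ la := (specht_dim C la).
Local Notation J := (@galift C n).

(** Averaging [Q] over the smaller group gives a multiple of [zid (ysym C be)] depending only on
    [Q 1], so one value of [Q] fixes the factor for all. *)
Lemma restriction_mult be nu : exists m : nat, (adds_box be nu -> (0 < m)%N) /\
  forall Q, Q * z_ be = Q ->
    kap_ nu * (J Q * z_ nu) 1%g = m%:R * (kap_ be * Q 1%g).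
Proof.
have pbe := ysym_primitive C be; have pnu := ysym_primitive C nu.
have k0 := kap_neq0 pbe; have f0 : n`!%:R != 0 :> C by rewrite pnatr_eq0 -lt0n
  fact_gt0.
(* The calibrating element is a primitive idempotent: [kap_ be * P 1] is 1, and [prim_mult] makes
   the other side an integer. *)
pose P := (kap_ be)^-1 *: ysym C be.
have PP : P * P = P.
  by rewrite /P -scalerAr -scalerAl (prim_sq pbe) !scalerA -mulrA mulVf // mulr1.
have Pz : P * z_ be = P by rewrite /P -scalerAl prim_zid.
have P1 : kap_ be * P 1%g = 1 by rewrite gscaleE ysym1 mulr1 mulfV.
have [|m mE m0] := @prim_mult _ _ _ pnu (J P); first by rewrite -galiftM PP.
exists m; split=> [be_nu|Q Qz].
  rewrite lt0n; apply: contraTneq be_nu => /m0 JPz;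
    apply/negP => /(@zid_galift_neq0 C).
  by apply/negP/negPn; move/eqP: JPz; rewrite /P linearZ /= -scalerAl scaler_eq0
    invr_eq0 (negPf k0).
have avgE R : R * z_ be = R ->
    n`!%:R * (J R * z_ nu) 1%g = kap_ be ^+ 2 * R 1%g * (z_ nu * J (z_ be)) 1%g.
  move=> Rz; rewrite -[J R * _](@zid_central _ _ _ (J R)) -coef1_central_gavg;
    last exact: zid_central.
  by rewrite -{1}Rz (gavg_zid pbe) Rz linearZ /= -scalerAr gscaleE.
apply: (mulfI f0); have := avgE _ Pz; have := avgE _ Qz; rewrite -mE.
move: (kap_ be) (P 1%g) (Q 1%g) k0 P1 => k p q k0 kp eQ eP.
have -> : n`!%:R * (kap_ nu * (J Q * z_ nu) 1%g) = kap_ nu * (k * q) * (k * (k * p)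
  * (z_ nu * J (z_ be)) 1%g) by rewrite kp mulrCA eQ; ring.
have -> : k * (k * p) * (z_ nu * J (z_ be)) 1%g = n`!%:R * (J P * z_ nu) 1%g.
  by rewrite eP; ring.
ring.
Qed.

End Restriction.

Definition zid_complete C n := \sum_(la : intpart n) zid (ysym C la) = 1.

(** For an idempotent [Q] in the block, [kap] times the coefficient at the identity is the rank of
    [Q] on one irreducible module, so this says that restriction is multiplicity free. *)
Definition branching C n := forall (be : intpart n) (nu : intpart n.+1) Q,
  Q * zid (ysym C be) = Q ->
  kap (ysym C nu) * (galift Q * zid (ysym C nu)) 1%g =
  (adds_box be nu)%:R * (kap (ysym C be) * Q 1%g).

(** The left side is the dimension of the module obtained by restricting and then inducing the
    Specht module of [be]. This inequality is what the induction carries from one size to the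
    next. *)
Definition dim_down_up C n := forall be : intpart n,
  (n * specht_dim C be <= \sum_(ga : intpart n.-1 | adds_box ga be)
     \sum_(be' : intpart n | adds_box ga be') specht_dim C be')%N.

Section Induction.
Variables (C : numClosedFieldType) (n : nat).
Implicit Types (be : intpart n) (nu : intpart n.+1) (Q : galg C 'S_n).
Local Notation z_ la := (zid (ysym C la)).
Local Notation kap_ la := (kap (ysym C la)).
Local Notation dim_ la := (specht_dim C la).
Local Notation J := (@galift C n).

Variable m : intpart n -> intpart n.+1 -> nat.
Hypothesis mE : forall be nu Q, Q * z_ be = Q ->
  kap_ nu * (J Q * z_ nu) 1%g = (m be nu)%:R * (kap_ be * Q 1%g).

Lemma dim_restriction nu : zid_complete C n ->
  dim_ nu = (\sum_be m be nu * dim_ be)%N.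
Proof.
move=> compl; apply/eqP; rewrite -(eqr_nat C) -kap_zid1 -[z_ nu]mul1r.
rewrite -(galift1 C n) -compl linear_sum /= mulr_suml gsumE mulr_sumr natr_sum.
apply/eqP/eq_bigr => be _; rewrite (@mE be nu) ?kap_zid1 ?natrM //.
exact/zidK/ysym_primitive.
Qed.

(** The idempotent [w] cuts out the part of the induced block not covered by Specht modules; its
    rank is [dim_ be] times the defect in the inequality. *)
Lemma dim_induction be :
  (\sum_nu m be nu * dim_ nu <= n.+1 * dim_ be)%N /\
  ((n.+1 * dim_ be <= \sum_nu m be nu * dim_ nu)%N <->
   J (z_ be) * (1 - \sum_nu z_ nu) = 0).
Proof.
set y := 1 - _; have yy : y * y = y := zid_compl_idem C n.+1.
have zz : z_ be * z_ be = z_ be by apply/zidK/ysym_primitive.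
have yC x : y * x = x * y.
  rewrite /y mulrBl mulrBr mul1r mulr1 mulr_suml mulr_sumr; congr (_ - _).
  by apply: eq_bigr => nu _; rewrite zid_central.
pose w := J (z_ be) * y.
have ww : w * w = w by rewrite /w -mulrA (mulrA y) yC -mulrA yy mulrA -galiftM zz.
have [r rE w0] := idem_trace ww.
have rE' : (r + dim_ be * \sum_nu m be nu * dim_ nu = n.+1 * dim_ be * dim_ be)%N.
  apply/eqP; rewrite -(eqr_nat C) natrD -rE card_Sn /w mulrBr mulr1 gaddE goppE.
  rewrite galift_coef1 mulr_sumr gsumE natrM natr_sum mulrBr mulr_sumr.
  have -> : (n.+1)`!%:R * z_ be 1%g = (n.+1 * dim_ be * dim_ be)%:R.
    transitivity (n.+1%:R * (dim_ be)%:R * (kap_ be * z_ be 1%g)).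
      by rewrite factS natrM (fact_kap C be); ring.
    by rewrite kap_zid1 !natrM.
  rewrite [X in _ - X + _](_ : _ = (dim_ be)%:R * (\sum_nu (m be nu * dim_ nu)%:R)).
    by rewrite subrK.
  rewrite mulr_sumr; apply: eq_bigr => nu _.
  transitivity ((dim_ nu)%:R * (kap_ nu * (J (z_ be) * z_ nu) 1%g)).
    by rewrite (fact_kap C nu); ring.
  by rewrite (@mE be nu) // kap_zid1 natrM; ring.
have d0 := specht_dim_gt0 C be.
split; first by rewrite -(leq_pmul2l d0) [X in (_ <= X)%N]mulnC -rE' leq_addl.
rewrite -/w -(leq_pmul2l d0) [X in (X <= _)%N]mulnC -rE'.
split=> [le|w0']; first by apply: w0; lia.
have: r%:R = 0 :> C by rewrite -rE w0' ffunE mulr0.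
by move/eqP; rewrite pnatr_eq0 => /eqP->.
Qed.

End Induction.

(** The number [n.+1 * dim be] is at most [dim be] plus the down-up sum of dimensions, hence at most
    the up-down sum, at most the sum of [dim nu] over the shapes above [be], at most the same sum
    weighted by multiplicities over all [nu], which is again at most [n.+1 * dim be]. Equality
    throughout forces multiplicities 0 or 1 and kills the complementary idempotent. *)
Lemma branching_step C n : zid_complete C n -> dim_down_up C n ->
  branching C n /\ zid_complete C n.+1.
Proof.
move=> compl down_up.
have /fin_all_exists[m mP] (p : intpart n * intpart n.+1) := restriction_mult C
  p.1 p.2.
pose m2 be nu := m (be, nu).
have m_pos be nu : adds_box be nu -> (0 < m2 be nu)%N := (mP (be, nu)).1.
have mE be nu Q : Q * zid (ysym C be) = Q ->
  kap (ysym C nu) * (galift Q * zid (ysym C nu)) 1%g =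
  (m2 be nu)%:R * (kap (ysym C be) * Q 1%g) := (mP (be, nu)).2 Q.
have le_down (nu : intpart n.+1) : (\sum_(be : intpart n | adds_box be nu)
  specht_dim C be <= specht_dim C nu)%N.
  rewrite (dim_restriction mE nu compl) big_mkcond; apply: leq_sum => be _.
  by case: ifP => // /m_pos; case: (m2 be nu) => // k _; rewrite leq_pmull.
have le_up (be : intpart n) : (\sum_(nu : intpart n.+1 | adds_box be nu)
  specht_dim C nu <=
                 \sum_nu m2 be nu * specht_dim C nu)%N.
  rewrite big_mkcond; apply: leq_sum => nu _.
  by case: ifP => // /m_pos; case: (m2 be nu) => // k _; rewrite leq_pmull.
have ge_up (be : intpart n) : (n.+1 * specht_dim C be <= \sum_(nu : intpart n.+1
  | adds_box be nu) specht_dim C nu)%N.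
  rewrite mulSn; apply: leq_trans (leq_add (leqnn _) (down_up be)) _.
  apply: leq_trans (sum_down_up _ _) _.
  by apply: leq_sum => nu _; apply: le_down.
have m_eq be nu : m2 be nu = adds_box be nu.
  have [le1 _] := dim_induction mE be.
  have := leq_trans le1 (ge_up be).
  rewrite (bigD1 nu) //= [X in (_ <= X)%N]big_mkcond [X in (_ <= X)%N](bigD1 nu)
    //=.
  have : (\sum_(i | i != nu) (if adds_box be i then specht_dim C i else 0) <=
          \sum_(i | i != nu) m2 be i * specht_dim C i)%N.
    apply: leq_sum => i _.
    by case: ifP => // /m_pos; case: (m2 be i) => // k _; rewrite leq_pmull.
  have := specht_dim_gt0 C nu; case: ifP => [/m_pos m0|_] d0 le2 le3.
    apply/eqP; rewrite eqn_leq m0 andbT -(leq_pmul2r d0) mul1n.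
    by rewrite -(leq_add2r (\sum_(i | i != nu) m2 be i * specht_dim C i))
      (leq_trans le3) ?leq_add2l.
  apply/eqP; rewrite -leqn0 -(leq_pmul2r d0) mul0n.
  by rewrite -(leq_add2r (\sum_(i | i != nu) m2 be i * specht_dim C i))
    (leq_trans le3) ?leq_add2l.
split=> [be nu Q Qz|]; first by rewrite (@mE be) // m_eq.
have zy0 be : galift (zid (ysym C be)) * (1 - \sum_nu zid (ysym C nu)) = 0 :>
  galg C 'S_n.+1.
  by apply/(dim_induction mE be).2; apply: leq_trans (ge_up be) (le_up be).
have : galift (\sum_(be : intpart n) zid (ysym C be)) * (1 - \sum_(nu : intpart
  n.+1) zid (ysym C nu)) = 0.
  by rewrite linear_sum /= mulr_suml big1 // => be _; apply: zy0.
by rewrite compl galift1 mul1r => /eqP; rewrite subr_eq0 => /eqP.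
Qed.

Lemma branching_dim_down C n (nu : intpart n.+1) : zid_complete C n -> branching
  C n ->
  specht_dim C nu = (\sum_(be : intpart n | adds_box be nu) specht_dim C be)%N.
Proof.
move=> compl br; rewrite (dim_restriction br nu compl) [RHS]big_mkcond.
by apply: eq_bigr => be _; case: ifP; rewrite ?mul1n ?mul0n.
Qed.

Lemma branching_dim_up C n (be : intpart n) : zid_complete C n.+1 -> branching C
  n ->
  (n.+1 * specht_dim C be = \sum_(nu : intpart n.+1 | adds_box be nu) specht_dim
    C nu)%N.
Proof.
move=> compl br; have [le1 [_ le2]] := dim_induction br be.
have e : (\sum_(nu : intpart n.+1) adds_box be nu * specht_dim C nu =
  \sum_(nu : intpart n.+1 | adds_box be nu) specht_dim C nu)%N.
  by rewrite [RHS]big_mkcond; apply: eq_bigr => nu _; case: ifP;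
    rewrite ?mul1n ?mul0n.
by rewrite -e; apply/eqP; rewrite eqn_leq le1 le2 // compl subrr mulr0.
Qed.

Lemma zid_complete0 C : zid_complete C 0.
Proof.
have gE (g : 'S_0) : g = 1%g by apply/permP => -[].
have zE (la : intpart 0) : zid (ysym C la) = 1.
  have e1 : ysym C la = 1.
    by apply/galgP=> g; rewrite (gE g) ysym1 ffunE eqxx.
  apply/galgP=> g; rewrite (gE g).
  rewrite zid1E; last exact: ysym_primitive.
  by rewrite /kap e1 mulr1 card_Sn [in RHS]ffunE ffunE !eqxx expr1n invr1 mulr1.
have [la _] : exists la : intpart 0, part la =1 fun=> 0%N.
  by apply: intpart_exists => //; rewrite big_ord0.
rewrite /zid_complete (bigD1 la) //= zE big1 ?addr0 // => mu.
by case/eqP; apply: part_inj => i; rewrite !part_default.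
Qed.

Lemma branching_complete C n : zid_complete C n /\ branching C n.
Proof.
suff [compl down_up] : zid_complete C n /\ dim_down_up C n.
  by split=> //; have [] := branching_step compl down_up.
elim: n => [|n [compl down_up]].
  by split=> [|be]; [apply: zid_complete0 | rewrite mul0n].
have [br compl'] := branching_step compl down_up; split=> // nu.
rewrite (branching_dim_down nu compl br) big_distrr /=.
by apply: leq_sum => be _; rewrite (branching_dim_up _ compl' br).
Qed.

(** * Characters of Specht modules *)

(** Factor [L = D *m B] through a basis [B] of [U]; quasi-idempotency gives [B *m D = k%:M], and
    cyclicity moves the trace onto the submodule. *)
Lemma mxtrace_submod_repr (F : fieldType) (gT : finGroupType) (G : {group gT})
    n (rG : mx_representation F G n) (U : 'M_n) (modU : mxmodule rG U)
    (L : 'M_n) (k : F) (s : gT) :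
  (L :=: U)%MS -> L *m L = k *: L -> s \in G ->
  \tr (L *m rG s) = k * \tr (submod_repr modU s).
Proof.
move=> LU LL Gs; pose B := val_submod (1%:M : 'M_(\rank U)).
have BU : (B <= U)%MS by apply: val_submodP.
pose D := in_submod U L.
have LE : L = D *m B by rewrite -val_submodE in_submodK ?LU.
have BL : B *m L = k *: B.
  have /submxP[E ->] : (B <= L)%MS by rewrite LU.
  by rewrite -mulmxA LL scalemxAr.
have BD : B *m D = k%:M.
  apply: (can_inj (@val_submodK _ _ U _)).
  rewrite [LHS]val_submodE -mulmxA -LE BL -scalemx1 linearZ /=.
  by rewrite -/B.
have BG : B *m rG s = submod_repr modU s *m B.
  by rewrite -val_submodE -[X in val_submod X]mul1mx; apply/esym/val_submodJ.
rewrite {1}LE -mulmxA mxtrace_mulC BG -mulmxA BD mul_mx_scalar mxtraceZ.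
by [].
Qed.

Section SpechtCharacter.
Variables (C : numClosedFieldType) (n : nat) (la : intpart n).
Local Notation G := [set: 'S_n]%G.
Local Notation aG := (Sn_regular C n).
Local Notation idx := (gring_index G).
Local Notation e := (ysym C la).

Lemma mul_regularE p (v : 'M_(p, #|G|)) (s : 'S_n) i j :
  (v *m aG s) i j = v i (idx (enum_val j * s^-1)%g).
Proof.
rewrite mxE (bigD1 (idx (enum_val j * s^-1)%g)) //= big1 => [|k nk].
  rewrite !mxE gring_indexK ?inE // mulgKV gring_valK !eqxx mulr1 addr0 //.
rewrite !mxE eqxx /=; case: eqP => [jE|]; last by rewrite mulr0.
by case/eqP: nk; rewrite jE gring_indexK ?inE // mulgK gring_valK.
Qed.

Lemma young_symmetrizerE j : young_symmetrizer C la 0 j = e (enum_val j).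
Proof.
have rowE : row_sum C la = \sum_(p in row_stab la) gdelta p.
  rewrite (galg_sum (row_sum C la)) [RHS]big_mkcond; apply: eq_bigr => p _.
  by rewrite row_sumE; case: ifP; rewrite ?scale1r ?scale0r.
have colE : col_sum C la = \sum_(q in col_stab la) (-1) ^+ q *: gdelta q.
  rewrite (galg_sum (col_sum C la)) [RHS]big_mkcond; apply: eq_bigr => p _.
  by rewrite col_sumE; case: ifP; rewrite ?mul1r ?mul0r ?scale0r.
rewrite /ysym rowE colE mulr_suml gsumE /young_symmetrizer summxE.
apply: eq_bigr => p _; rewrite mulr_sumr gsumE summxE.
apply: eq_bigr => q _; rewrite -scalerAr -gdeltaM gscaleE gdeltaE !mxE eqxx /=.
by rewrite -(inj_eq enum_val_inj) gring_indexK ?inE.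
Qed.

(** Left multiplication by [e] as in [lmul_mx], but in the enumeration of [[set: 'S_n]] used by the
    regular representation. *)
Let L : 'M[C]_#|G| := \matrix_(i, j) e (enum_val j * (enum_val i)^-1)%g.

Lemma regular_lmulC s : L *m aG s = aG s *m L.
Proof.
apply/matrixP=> i j; rewrite mul_regularE !mxE gring_indexK ?inE //.
rewrite (bigD1 (idx (enum_val i * s)%g)) //= big1 => [|k nk].
  by rewrite !mxE !eqxx mul1r addr0 gring_indexK ?inE // invMg mulgA.
by rewrite !mxE (negPf nk) mul0r.
Qed.

Lemma regular_lmul_sq : L *m L = kap e *: L.
Proof.
have ee := prim_sq (ysym_primitive C la).
apply/matrixP=> i j; rewrite !mxE -gscaleE -ee gmulE.
rewrite (reindex (fun g => idx (g * enum_val i)%g)) /=; last first.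
  exists (fun k => enum_val k * (enum_val i)^-1)%g => [g _|k _].
    by rewrite /= (gring_indexK _ (in_setT _)) mulgK.
  by rewrite mulgKV gring_valK.
rewrite [RHS](reindex_inj (mulgI (enum_val j * (enum_val i)^-1)%g)) /=.
rewrite [RHS](reindex_inj invg_inj) /=; apply: eq_bigr => g _.
rewrite !mxE !(gring_indexK _ (in_setT _)) mulgK mulrC.
by rewrite [in RHS]invMg invgK mulgKV invMg mulgA.
Qed.

Lemma regular_lmul_cyclic : (L :=: cyclic_mx aG (young_symmetrizer C la))%MS.
Proof.
apply/eqmxP/andP; split.
  apply/row_subP => i; apply: (@submx_trans _ _ _ _ _ _ (young_symmetrizer C la
    *m aG (enum_val i))).
    suff -> : row i L = young_symmetrizer C la *m aG (enum_val i) by [].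
    by apply/rowP=> j; rewrite mul_regularE young_symmetrizerE !mxE gring_indexK
      ?inE.
  exact: (mxmodule_trans (cyclic_mx_module _ _) (in_setT _) (cyclic_mx_id _ _)).
apply: cyclic_mx_sub.
  by apply/mxmoduleP => s _; rewrite regular_lmulC submxMl.
suff -> : young_symmetrizer C la = row (idx 1%g) L by apply: row_sub.
by apply/rowP => j; rewrite young_symmetrizerE !mxE gring_indexK ?inE // invg1
  mulg1.
Qed.

(** The trace of [u |-> e * u * s] is both the conjugation sum of [e] at the inverse of [s] and
    [kap e] times the character. *)
Lemma Sn_charE (s : 'S_n) : Sn_char C la s = kap e * zid e s^-1%g.
Proof.
have k0 := kap_neq0 (ysym_primitive C la); apply: (mulfI k0).
rewrite /Sn_char /specht_repr -(mxtrace_submod_repr _ regular_lmul_cyclic) ?inE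
  //; last exact: regular_lmul_sq.
rewrite gscaleE !mulrA -expr2 mulfV ?expf_neq0 // mul1r gsumE /mxtrace.
under eq_bigr => i _ do rewrite mul_regularE mxE gring_indexK ?inE //.
rewrite (reindex_inj invg_inj) (reindex (fun g => idx g)) /=; last first.
  exists enum_val => [g _|k _]; [exact: gring_indexK (in_setT g) | exact:
    gring_valK].
apply: eq_bigr => g _.
by rewrite gconjE gring_indexK ?inE // conjgE invgK mulgA.
Qed.

End SpechtCharacter.

(** * Immanants of Gram matrices *)

Local Open Scope sesquilinear_scope.

Section GeneralizedImmanant.
Variables (C : numClosedFieldType) (n : nat).
Implicit Types (A : 'M[C]_n) (x y : galg C 'S_n) (g : 'S_n).

(* The inverse makes [gimm A (gdelta u)] the product of the [A (u i) i]. *)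
Definition gimm A x : C := \sum_(s : 'S_n) x s^-1%g * \prod_i A i (s i).

Lemma gimmZ A c x : gimm A (c *: x) = c * gimm A x.
Proof. by rewrite mulr_sumr; apply: eq_bigr => s _; rewrite gscaleE mulrA. Qed.

Lemma gimm_sum A I (r : seq I) (P : pred I) (f : I -> galg C 'S_n) :
  gimm A (\sum_(i <- r | P i) f i) = \sum_(i <- r | P i) gimm A (f i).
Proof.
rewrite /gimm exchange_big /=; apply: eq_bigr => s _.
by rewrite gsumE mulr_suml.
Qed.

Lemma gimm_gdelta A u : gimm A (gdelta u) = \prod_i A (u i) i.
Proof.
rewrite /gimm (bigD1 u^-1%g) //= [X in _ + X]big1 => [|s ns].
  rewrite gdeltaE invgK eqxx mul1r addr0 (reindex_inj (@perm_inj _ u)) /=.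
  by apply: eq_bigr => i _; rewrite permK.
rewrite gdeltaE; case: eqP => [us|]; last by rewrite mul0r.
by rewrite -us invgK eqxx in ns.
Qed.

Lemma immanantE A (la : intpart n) :
  immanant la A = kap (ysym C la) * gimm A (zid (ysym C la)).
Proof. by rewrite mulr_sumr; apply: eq_bigr => s _; rewrite Sn_charE mulrA. Qed.

Lemma gimm_gconj A g x :
  gimm A (gconj g x) = gimm (\matrix_(i, j) A (g^-1%g i) (g^-1%g j)) x.
Proof.
rewrite /gimm (reindex_inj (conjg_inj g^-1%g)) /=; apply: eq_bigr => s _.
rewrite gconjE -conjVg -conjgM mulVg conjg1; congr (_ * _).
rewrite (reindex_inj (@perm_inj _ g^-1%g)) /=.
by apply: eq_bigr => i _; rewrite permJ mxE.
Qed.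

Definition gram A := exists w : 'I_n -> 'I_n -> C,
  forall i j, A i j = \sum_k (w k i)^* * w k j.

Lemma gram_perm A g : gram A -> gram (\matrix_(i, j) A (g i) (g j)).
Proof. by case=> w wE; exists (fun k i => w k (g i)) => i j; rewrite mxE wE. Qed.

Lemma gram_herm A i j : gram A -> A i j = (A j i)^*.
Proof.
case=> w wE; rewrite !wE rmorph_sum; apply: eq_bigr => k _ /=.
by rewrite rmorphM /= conjCK mulrC.
Qed.

Lemma psd_gram A : A \is hermsymmx ->
  (forall x : 'cV[C]_n, 0 <= (x ^t* *m A *m x) 0 0) -> gram A.
Proof.
move=> hA psdA; have /orthomx_spectralP := hermitian_normalmx hA.
set P := spectralmx A; set d := spectral_diag A => AE.
have Pu : P \is unitarymx by apply: spectral_unitarymx.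
rewrite invmx_unitary // in AE.
have d_ge0 k : 0 <= d 0 k.
  (* Testing on the k-th eigenvector isolates the k-th eigenvalue. *)
  have := psdA ((row k P)^t*); rewrite trmxCK AE !mulmxA.
  have -> : row k P *m P^t* = delta_mx 0 k.
    by rewrite -row_mul (unitarymxP Pu) row1.
  have -> : delta_mx 0 k *m diag_mx d *m P *m (row k P)^t* = (d 0 k)%:M.
    rewrite -rowE row_diag_mx -scalemxAl -rowE -scalemxAl.
    have -> : row k P *m (row k P)^t* = 1%:M.
      apply/matrixP=> i j; rewrite !ord1.
      have /matrixP/(_ k k) := unitarymxP Pu.
      rewrite !mxE eqxx => <-; apply: eq_bigr => l _; by rewrite !mxE.
    by rewrite scalemx1.
  by rewrite mxE eqxx.
exists (fun k i => sqrtC (d 0 k) * P k i) => i j; rewrite AE mxE.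
apply: eq_bigr => k _; rewrite mul_mx_diag !mxE rmorphM /=.
rewrite [(sqrtC _)^*](CrealP (ger0_real _)) ?sqrtC_ge0 //.
rewrite -[X in _ * X * _](sqrtCK (d 0 k)). ring.
Qed.

End GeneralizedImmanant.

Section Positivity.
Variables (C : numClosedFieldType) (n : nat) (A : 'M[C]_n.+2).
Local Notation J := (@galift C n.+1).

Definition last_tperm : 'S_n.+2 := tperm (lift ord_max ord_max) ord_max.

(* The transposition contracts the last two tensor factors, which turns the
   value into a sum of squares. *)
Lemma gimm_last_tperm_ge0 (y : galg C 'S_n.+1) : gram A ->
  0 <= gimm A (star (J y) * gdelta last_tperm * J y).
Proof.
move=> gA; have [w wE] := gA; pose m : 'I_n.+2 := lift ord_max ord_max.
pose jj (j : 'I_n) : 'I_n.+2 := lift ord_max (lift ord_max j).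
have widenE p (j : 'I_p) : widen_ord (leqnSn p) j = lift ord_max j.
  by apply/esym/val_inj/lift_max.
(* The function [f] chooses a Gram index for each of the first [n] positions. *)
pose V (f : {ffun 'I_n -> 'I_n.+2}) := \sum_(h : 'S_n.+1)
  (y h)^* * A ord_max (lft h m) * \prod_j w (f j) (lft h (jj j)).
suff -> : gimm A (star (J y) * gdelta last_tperm * J y) = \sum_f V f * (V f)^*.
  by apply: sumr_ge0 => f _; apply: mul_conjC_ge0.
(* Position [m] contributes a factor depending on [h] alone, and the last position one depending on
   [h'] alone; the remaining positions separate after the Gram expansion. *)
have prodE h h' : \prod_i A ((lft h^-1 * last_tperm * lft h')%g i) i =
    A ord_max (lft h m) * (A ord_max (lft h' m))^* *
    \sum_(f : {ffun 'I_n -> 'I_n.+2})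
      \prod_j ((w (f j) (lft h' (jj j)))^* * w (f j) (lft h (jj j))).
  rewrite (reindex_inj (@perm_inj _ (lft h))) /=.
  have F i : A ((lft h^-1 * last_tperm * lft h')%g (lft h i)) (lft h i) =
      A (lft h' (last_tperm i)) (lft h i).
    by rewrite !permM lftV permK.
  rewrite (eq_bigr _ (fun i _ => F i)) !big_ord_recr /= !widenE -/m.
  rewrite /last_tperm tpermL tpermR {2 3}/lft !lift_perm_id.
  rewrite -/m (gram_herm (lft h' m) ord_max gA) -mulrA [LHS]mulrC.
  rewrite -(bigA_distr_bigA (fun j k => (w k (lft h' (jj j)))^* * w k (lft h (jj
    j)))).
  congr (_ * _); apply: eq_bigr => j _; rewrite -wE !widenE tpermD //.
    by rewrite (inj_eq (@lift_inj _ _)) neq_lift.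
  by rewrite neq_lift.
have xE : star (J y) * gdelta last_tperm * J y =
    \sum_h \sum_h' ((y h)^* * y h') *: gdelta (lft h^-1 * last_tperm * lft h')%g.
  rewrite star_galift (galg_sum (star y)) (reindex_inj invg_inj) linear_sum /=.
  rewrite {2}(galg_sum y) linear_sum /= !mulr_suml; apply: eq_bigr => h _.
  rewrite mulr_sumr; apply: eq_bigr => h' _.
  rewrite starE invgK !linearZ /= -!scalerAl -scalerAr scalerA.
  by rewrite !galift_gdelta !gdeltaM.
rewrite xE gimm_sum.
under eq_bigr => h _ do rewrite gimm_sum.
under eq_bigr => h _ do under eq_bigr => h' _ do rewrite gimmZ gimm_gdelta prodE
  mulrA mulr_sumr.
under eq_bigr => h _ do rewrite exchange_big /=.
rewrite exchange_big /=; apply: eq_bigr => f _.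
rewrite /V rmorph_sum mulr_suml; apply: eq_bigr => h _.
rewrite mulr_sumr; apply: eq_bigr => h' _ /=.
rewrite big_split /= !rmorphM /= conjCK rmorph_prod /=.
ring.
Qed.

End Positivity.

(** * Jucys-Murphy elements *)

Section JucysMurphy.
Variable C : numClosedFieldType.

(* Twice the Jucys-Murphy element. *)
Definition jucys2 n : galg C 'S_n.+1 := tperm_sum C n.+1 - galift (tperm_sum C n).

Lemma lft_tperm n (i j : 'I_n) :
  lft (tperm i j) = tperm (lift ord_max i) (lift ord_max j).
Proof.
apply/permP => k; case: (unliftP ord_max k) => [l|] ->.
  by rewrite lift_perm_lift inj_tperm //; apply: lift_inj.
by rewrite lift_perm_id tpermD // eq_sym neq_lift.
Qed.

Lemma jucys2E n : jucys2 n = \sum_(i < n) gdelta (tperm (lift ord_max i) ord_max)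
  *+ 2.
Proof.
have widenE (j : 'I_n) : widen_ord (leqnSn n) j = lift ord_max j.
  by apply/esym/val_inj/lift_max.
pose t (i j : 'I_n.+1) : galg C 'S_n.+1 := if i != j then gdelta (tperm i j) else 0.
have rowE i : \sum_(j | i != j) gdelta (tperm i j) =
    \sum_(j < n) t i (lift ord_max j) + t i ord_max.
  rewrite big_mkcond big_ord_recr /=; congr (_ + _).
  by apply: eq_bigr => j _; rewrite widenE.
have sumE : tperm_sum C n.+1 = galift (tperm_sum C n) +
    \sum_(i < n) gdelta (tperm (lift ord_max i) ord_max) *+ 2.
  rewrite /tperm_sum (eq_bigr _ (fun i _ => rowE i)) big_ord_recr /=.
  rewrite big_split /= -!addrA; congr (_ + _).
    rewrite linear_sum; apply: eq_bigr => i _ /=.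
    rewrite linear_sum [RHS]big_mkcond; apply: eq_bigr => j _ /=.
    rewrite widenE /t (inj_eq (@lift_inj _ _)); case: ifP => // _.
    by rewrite galift_gdelta lft_tperm.
  rewrite {3}/t eqxx addr0 -big_split /=; apply: eq_bigr => i _.
  by rewrite widenE /t neq_lift eq_sym neq_lift tpermC -mulr2n.
by rewrite /jucys2 sumE addrAC subrr add0r.
Qed.

(** Conjugation by the last transposition lowers each summand to the smaller group, except the one
    equal to that transposition, whose square is 1; the constant is 2 since everything is
    doubled. *)
Lemma jucys2_last_tperm n : jucys2 n.+1 * gdelta (last_tperm n) =
  gdelta (last_tperm n) * galift (jucys2 n) + 2%:R.
Proof.
have widenE (j : 'I_n) : widen_ord (leqnSn n) j = lift ord_max j.
  by apply/esym/val_inj/lift_max.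
rewrite !jucys2E big_ord_recr /= mulrDl mulr_suml linear_sum mulr_sumr.
have last2 : gdelta (last_tperm n) * gdelta (last_tperm n) = 1 :> galg C _.
  by rewrite -gdeltaM /last_tperm tperm2.
congr (_ + _); last by rewrite mulrnAl last2.
apply: eq_bigr => i _; rewrite mulrnAl /= raddfMn /= mulrnAr; congr (_ *+ 2).
rewrite galift_gdelta lft_tperm widenE -!gdeltaM; congr gdelta.
rewrite conjgC tpermJ /last_tperm tpermR tpermD //.
  by rewrite (inj_eq (@lift_inj _ _)) neq_lift.
by rewrite neq_lift.
Qed.

End JucysMurphy.

(** * The sum of immanants as one value of the generalized immanant *)

Section ImmanantSum.
Variables (C : numClosedFieldType) (n : nat).
Variables (be : intpart n.+1) (ga : intpart n) (ga_be : adds_box ga be).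
Local Notation J := (@galift C _).
Local Notation z_ la := (zid (ysym C la)).
Local Notation kap_ la := (kap (ysym C la)).
Local Notation dim_ la := (specht_dim C la).

(** The star swaps the row and column factors of the symmetrizer, and averages ignore the order of
    factors. *)
Lemma star_zid m (la : intpart m) : star (z_ la) = z_ la.
Proof.
rewrite starZ star_gavg star_ysym gavgC -/(ysym C la); congr (_ *: _).
apply/CrealP; rewrite realV realX // gtr0_real // kap_real_gt0 //.
exact: ysym_primitive.
Qed.

Let y : galg C 'S_n.+1 := z_ be * J (z_ ga).
Let s : galg C 'S_n.+2 := gdelta (last_tperm n).
Let x := J y * s * J y.

Let zbK : z_ be * z_ be = z_ be. Proof. exact/zidK/ysym_primitive. Qed.
Let zgK : z_ ga * z_ ga = z_ ga. Proof. exact/zidK/ysym_primitive. Qed.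

Let star_y : star y = y.
Proof. by rewrite starM star_galift !star_zid -zid_central. Qed.

Let yzb : y * z_ be = y.
Proof. by rewrite -[y * _]zid_central mulrA zbK. Qed.

Let yy : y * y = y.
Proof. by rewrite {2}/y mulrA yzb -mulrA -galiftM zgK. Qed.

Let tperm_sum_y : tperm_sum C n.+1 * y = (2 * total_content be)%:~R *: y.
Proof. by rewrite /y mulrA zid_tperm_sum scalerAl. Qed.

Let jucys_y : jucys2 C n * y = (2 * (total_content be - total_content ga))%:~R *: y.
Proof.
rewrite /jucys2 mulrBl tperm_sum_y mulrBr rmorphB scalerBl; congr (_ - _).
by rewrite /y mulrA -[J _ * z_ be]zid_central -mulrA -galiftM zid_tperm_sum
  linearZ /= scalerAr.
Qed.

(** Evaluate [z_ nu * (J y * (jucys2 C n.+1 * s) * J y)] twice: on the left the Jucys-Murphy element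
    is a difference of two central sums acting by total contents; after commuting past [s] its
    smaller analogue acts on [J y]. *)
Let sandwich nu : (2 * (total_content nu - total_content be))%:~R *: (z_ nu * x) =
  (2 * (total_content be - total_content ga))%:~R *: (z_ nu * x) + (z_ nu * J y)
    *+ 2.
Proof.
have comm_y : y * tperm_sum C n.+1 = tperm_sum C n.+1 * y by rewrite
  tperm_sum_central.
have zT u : z_ nu * (tperm_sum C n.+2 * u) = (2 * total_content nu)%:~R *: (z_ nu
  * u).
  by rewrite mulrA zid_central zid_tperm_sum scalerAl.
have JT : J y * (J (tperm_sum C n.+1) * s) * J y = (2 * total_content be)%:~R *: x.
  by rewrite mulrA -galiftM comm_y tperm_sum_y linearZ /= -2!scalerAl.
have -> : (2 * (total_content nu - total_content be))%:~R *: (z_ nu * x) =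
    z_ nu * (J y * (jucys2 C n.+1 * s) * J y).
  rewrite mulrBr rmorphB scalerBl /jucys2 mulrBl mulrBr mulrBl mulrBr;
    congr (_ - _).
    by rewrite -zT /x [J y * (_ * s)]mulrA -[J y * tperm_sum C
      n.+2]tperm_sum_central !mulrA.
  by rewrite JT scalerAr.
rewrite jucys2_last_tperm mulrDr mulrDl mulrDr; congr (_ + _).
  by rewrite /x -!mulrA -galiftM jucys_y linearZ /= !scalerAr.
by rewrite mulr_natr mulrnAl mulrnAr -galiftM yy.
Qed.

(** On the block of [nu] the relation [sandwich] replaces [x] by [J y] divided by the content
    difference. Applying [branching] twice gives [J y] the rank [dim_ ga] there. *)
Lemma gimm_sandwich (A : 'M[C]_n.+2) : gimm A (gavg x) = (dim_ ga)%:R *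
  \sum_(nu | adds_box be nu) immanant nu A
    / (skew_content nu be - skew_content be ga)%:~R.
Proof.
have [compl _] := branching_complete C n.+2;
  have [_ br] := branching_complete C n.+1.
have [_ br'] := branching_complete C n.
rewrite -[gavg x]mul1r -compl mulr_suml gimm_sum big_distrr /= [RHS]big_mkcond.
apply: eq_bigr => nu _; rewrite -gavgMl; last exact: zid_central.
have pnu := ysym_primitive C nu; have k0 := kap_neq0 pnu.
have coefE : kap_ nu * (J y * z_ nu) 1%g = (adds_box be nu)%:R * (dim_ ga)%:R.
  rewrite (br be nu _ yzb) /y zid_central (br' ga be _ zgK).
  by rewrite ga_be mul1r kap_zid1.
case: ifP => be_nu; rewrite be_nu ?mul1r ?mul0r in coefE; last first.
  (* If [nu] does not contain [be], branching gives [J y] rank 0 on this block, so the block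
     contributes nothing. *)
  have [|r rE r0] := prim_mult pnu (P := J y); first by rewrite -galiftM yy.
  have Jyz0 : J y * z_ nu = 0.
    by apply: r0; apply/eqP; rewrite -(pnatr_eq0 C) -rE coefE.
  have -> : z_ nu * x = 0 by rewrite /x !mulrA [z_ nu * _]zid_central Jyz0 !mul0r.
  by rewrite -(scale0r 0) gavgZ gimmZ mul0r.
have d0 := skew_content_neq ga_be be_nu.
set d := _ - _ in d0 *; have d0C : d%:~R != 0 :> C by rewrite intr_eq0.
have zx : z_ nu * x = d%:~R^-1 *: (J y * z_ nu).
  apply: (scalerI d0C); rewrite scalerA mulfV // scale1r.
  have two0 : 2%:R != 0 :> C by rewrite pnatr_eq0.
  have AB : (2 * (total_content nu - total_content be))%:~R =
      2%:R * d%:~R + (2 * (total_content be - total_content ga))%:~R :> C.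
    by rewrite (total_content_add be_nu) (total_content_add ga_be) /d; ring.
  apply: (scalerI two0); have := sandwich nu.
  by rewrite AB scalerDl addrC => /addrI; rewrite -scalerA -scaler_nat [z_ nu * J
    y]zid_central.
rewrite zx gavgZ gavg_zid // 2!gimmZ immanantE expr2 -(mulrA (kap_ nu)) coefE.
by ring.
Qed.

Lemma gimm_sandwich_ge0 (A : 'M[C]_n.+2) : gram A -> 0 <= gimm A (gavg x).
Proof.
move=> gA; rewrite gimm_sum; apply: sumr_ge0 => g _; rewrite gimm_gconj.
have -> : x = star (J y) * s * J y by rewrite star_galift star_y.
by apply/gimm_last_tperm_ge0/gram_perm.
Qed.

Lemma immanant_sum_ge0 (A : 'M[C]_n.+2) : gram A ->
  0 <= \sum_(nu | adds_box be nu) immanant nu A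
         / (skew_content nu be - skew_content be ga)%:~R.
Proof.
move=> /gimm_sandwich_ge0; rewrite gimm_sandwich pmulr_rge0 //.
by rewrite ltr0n specht_dim_gt0.
Qed.

End ImmanantSum.

Local Open Scope complex_scope.

Theorem theorem1p6 (R : realType) (n : nat) (n_ge2 : (2 <= n)%N)
    (beta : intpart n.-1) (gamma : intpart n.-2)
    (gamma_beta : adds_box gamma beta) :
  (forall nu : intpart n, adds_box beta nu ->
     skew_content nu beta - skew_content beta gamma != 0) /\
  (forall A : 'M[R[i]]_n, psdmx A ->
     0 <= \sum_(nu : intpart n | adds_box beta nu)
            immanant nu A
              / (skew_content nu beta - skew_content beta gamma)%:~R).
Proof.
case: n n_ge2 beta gamma gamma_beta => [//|[//|n]] _ beta gamma gamma_beta.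
split=> [nu beta_nu | A [hA psdA]]; first exact: skew_content_neq beta_nu.
by apply: immanant_sum_ge0 => //; apply: psd_gram.
Qed.
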